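(* Let $n\in\mathbb{Z}_{\ge3}$, $n=n_0\cdot2^{\alpha}$, with $n_0$ odd and $\alpha\in\mathbb{Z}_{\ge0}$. Then $$ \mathsf{GT}(\mathsf{K}^{(n)})\cong\begin{cases}\mathrm{Aff}(\mathbb{Z}/n_0\mathbb{Z})\times\mathcal{Z}_2&\text{if }\alpha<2,\\ \mathrm{Aff}(\mathbb{Z}/n_0\mathbb{Z})\times\tilde H_\alpha&\text{if }\alpha\ge2,\end{cases} $$ where $\mathcal{Z}_2$ is the cyclic group of order $2$ and $\tilde H_\alpha$ is the following index $2$ subgroup of $\mathbb{Z}/2^{\alpha-1}\mathbb{Z}\rtimes(\mathbb{Z}/2^{\alpha+1}\mathbb{Z})^\times$: $$ \tilde H_\alpha:=\big\{(\overline k,(-\overline1)^a\,\overline5^{\,b})\in\mathbb{Z}/2^{\alpha-1}\mathbb{Z}\rtimes(\mathbb{Z}/2^{\alpha+1}\mathbb{Z})^\times\ \big|\ k\equiv b\bmod2\big\}. $$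
   Context: **Semidirect products.** For positive integers $n\mid q$, $\mathbb{Z}/n\mathbb{Z}\rtimes(\mathbb{Z}/q\mathbb{Z})^\times$ has multiplication $(\overline k_1,\overline u_1)(\overline k_2,\overline u_2)=(\overline k_1+\overline u_1\overline k_2,\overline u_1\overline u_2)$, where units mod $q$ act on $\mathbb{Z}/n\mathbb{Z}$ through reduction mod $n$. $\mathrm{Aff}(R)=R\rtimes R^\times$ for a commutative ring $R$. For $\alpha\ge2$, $(\mathbb{Z}/2^{\alpha+1}\mathbb{Z})^\times$ is the internal direct product of $\langle-\overline1\rangle$ (order $2$) and $\langle\overline5\rangle$ (order $2^{\alpha-1}$), so every unit is $(-\overline1)^a\overline5^b$ with $b$ well defined modulo $2^{\alpha-1}$. **Braid groups.** $\mathrm{B}_3=\langle \sigma_1,\sigma_2\mid \sigma_1\sigma_2\sigma_1=\sigma_2\sigma_1\sigma_2\rangle$; $\mathrm{PB}_3$ is the kernel of the standard homomorphism $\mathrm{B}_3\to S_3$; $x_{12}:=\sigma_1^2$, $x_{23}:=\sigma_2^2$, $c:=(\sigma_1\sigma_2\sigma_1)^2$. One has $\mathrm{PB}_3=\langle x_{12},x_{23}\rangle\times\langle c\rangle$ with $\langle x_{12},x_{23}\rangle$ free; $\mathsf{F}_2$ denotes the subgroup $\langle x_{12},x_{23}\rangle$, with $x:=x_{12}$, $y:=x_{23}$. $\mathsf{NFI}_{\mathrm{PB}_3}(\mathrm{B}_3)$ is the set of finite index normal subgroups $\mathsf{N}\unlhd\mathrm{B}_3$ with $\mathsf{N}\le\mathrm{PB}_3$.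 For such $\mathsf{N}$: $\mathsf{N}_{\mathsf{F}_2}:=\mathsf{N}\cap\mathsf{F}_2$, and $N_{\mathrm{ord}}$ is the lcm of the orders of $x_{12}\mathsf{N}$, $x_{23}\mathsf{N}$, $c\mathsf{N}$ in $\mathrm{PB}_3/\mathsf{N}$. **$\mathsf{GT}$-shadows.** For $(m,f)\in\mathbb{Z}\times\mathsf{F}_2$, $[m,f]:=(m+N_{\mathrm{ord}}\mathbb{Z}, f\mathsf{N}_{\mathsf{F}_2})$. $\mathsf{GT}(\mathsf{N})$ is the set of those $[m,f]\in\mathbb{Z}/N_{\mathrm{ord}}\mathbb{Z}\times\mathsf{F}_2/\mathsf{N}_{\mathsf{F}_2}$ such that: (i) the hexagon relations hold: $\sigma_1^{2m+1}f^{-1}\sigma_2^{2m+1}f\,\mathsf{N}=f^{-1}\sigma_1\sigma_2x_{12}^{-m}c^m\,\mathsf{N}$ and $f^{-1}\sigma_2^{2m+1}f\sigma_1^{2m+1}\,\mathsf{N}=\sigma_2\sigma_1x_{23}^{-m}c^mf\,\mathsf{N}$; (ii) $\gcd(2m+1,N_{\mathrm{ord}})=1$ and $f\mathsf{N}_{\mathsf{F}_2}\in[\mathsf{F}_2/\mathsf{N}_{\mathsf{F}_2},\mathsf{F}_2/\mathsf{N}_{\mathsf{F}_2}]$; (iii) the homomorphism $T_{m,f}:\mathrm{B}_3\to\mathrm{B}_3/\mathsf{N}$, $\sigma_1\mapsto\sigma_1^{2m+1}\mathsf{N}$, $\sigma_2\mapsto f^{-1}\sigma_2^{2m+1}f\,\mathsf{N}$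 (well defined by (i)), is surjective. $\mathsf{N}$ is called isolated if $\ker T_{m,f}=\mathsf{N}$ for all $[m,f]\in\mathsf{GT}(\mathsf{N})$; then $\mathsf{GT}(\mathsf{N})$ is a finite group under $[m_1,f_1]\circ[m_2,f_2]=[2m_1m_2+m_1+m_2,\ f_1E_{m_1,f_1}(f_2)]$, where $E_{m,f}\in\mathrm{End}(\mathsf{F}_2)$ is given by $x\mapsto x^{2m+1}$, $y\mapsto f^{-1}y^{2m+1}f$. **The subgroups $\mathsf{K}^{(n)}$.** For an integer $n\ge3$ let $D_n=\langle r,s\mid r^n,s^2,srs^{-1}r\rangle$, and let $\psi_n:\mathrm{PB}_3\to D_n^3$ be the homomorphism $\psi_n(x_{12})=(r,s,s)$, $\psi_n(x_{23})=(rs,r,rs)$, $\psi_n(c)=(1,1,1)$. Set $\mathsf{K}^{(n)}:=\ker\psi_n$. It is a fact that $\mathsf{K}^{(n)}\in\mathsf{NFI}_{\mathrm{PB}_3}(\mathrm{B}_3)$ and that it is isolated, so $\mathsf{GT}(\mathsf{K}^{(n)})$ is a finite group. *)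

(* Defs.v *)
From HB Require Import structures.
From mathcomp Require Import all_boot all_order all_fingroup all_algebra.
From mathcomp Require Import generic_quotient cyclic zify.
From mathcomp Require Import boolp classical_sets functions.

Set Implicit Arguments.
Unset Strict Implicit.
Unset Printing Implicit Defensive.

Import GroupScope.
Local Open Scope quotient_scope.
Local Open Scope classical_set_scope.
Local Open Scope group_scope.

Section GroupGeneralities.
Variable G : groupType.
Implicit Types (A : set G) (x y : G).

Definition expgz x (m : int) : G :=
  match m with Posz k => x ^+ k | Negz k => x ^- k.+1 end.

Inductive gen A : set G :=
| gen_in x of A x : gen A x
| gen_1 : gen A 1
| gen_M x y of gen A x & gen A y : gen A (x * y)
| gen_V x of gen A x : gen A x^-1.

Definition gp A : Type := {x : G | x \in gen A}.

Lemma gen_closed A : group_closed (fun x => x \in gen A).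
Proof.
split; first by rewrite inE; exact: gen_1.
by move=> x y; rewrite !inE => hx hy; apply: gen_M => //; apply: gen_V.
Qed.

HB.instance Definition _ A := SubChoice.on (gp A).
HB.instance Definition _ A :=
  SubChoice_isSubGroup.Build G (fun x => x \in gen A) (gp A) (gen_closed A).

Definition commutator_subgroup : set G :=
  gen [set z | exists x y, z = [~ x, y]].

(* The least positive k with x ^+ k = 1, or 0 if there is none. *)
Definition gorder x : nat :=
  xget 0%N [set k | [/\ (0 < k)%N, x ^+ k = 1 &
    forall j, (0 < j)%N -> x ^+ j = 1 -> (k <= j)%N]].

Definition normal_closure A : set G :=
  gen [set z | exists a h, A a /\ z = a ^ h].

Definition cosets_rel A : rel G := fun x y => `[< normal_closure A (x^-1 * y) >].

Lemma normal_closureJ A x y : normal_closure A x -> normal_closure A (x ^ y).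
Proof.
elim=> [_ [a [h [Aa ->]]]||u v _ IHu _ IHv|u _ IHu].
- by apply: gen_in; exists a, (h * y); rewrite conjgM.
- by rewrite conj1g; apply: gen_1.
- by rewrite conjMg; apply: gen_M.
- by rewrite conjVg; apply: gen_V.
Qed.

Lemma cosets_rel_equiv A : equiv_class_of (cosets_rel A).
Proof.
split=> [x|x y|y x z].
- by apply/asboolP; rewrite mulVg; apply: gen_1.
- by apply/asboolP/asboolP => /gen_V; rewrite invgM invgK.
- move=> /asboolP hxy /asboolP hyz; apply/asboolP.
  by have := gen_M hxy hyz; rewrite mulgA mulgK.
Qed.

Canonical cosets_equiv A := EquivRelPack (cosets_rel_equiv A).

Lemma normal_closure_id A :
  A 1 -> (forall x y, A x -> A y -> A (x * y)) -> (forall x, A x -> A x^-1) ->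
  (forall x y, A x -> A (x ^ y)) -> normal_closure A = A.
Proof.
move=> A1 AM AV AJ; apply/seteqP; split=> [z|z Az]; last first.
  by apply: gen_in; exists z, 1; rewrite conjg1.
by elim=> // [_ [a [h [Aa ->]]]|u v _ Au _ Av|u _ Au]; [exact: AJ|exact: AM|exact: AV].
Qed.

(* The quotient of G by the normal closure of A. When A is a normal subgroup
   it is its own normal closure (normal_closure_id), so quo A is G / A. *)
Definition quo A : Type := {eq_quot cosets_rel A}.

HB.instance Definition _ A := Choice.on (quo A).
HB.instance Definition _ A := EqQuotient.on (quo A).

Section QuoGroup.
Variable A : set G.

Lemma quoP x y : reflect (normal_closure A (x^-1 * y)) (x == y %[mod quo A]).
Proof. by rewrite eqmodE; apply: (iffP idP) => /asboolP. Qed.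

Definition quo_mul (a b : quo A) : quo A := \pi_(quo A) (repr a * repr b).
Definition quo_inv (a : quo A) : quo A := \pi_(quo A) (repr a)^-1.
Definition quo_one : quo A := \pi_(quo A) 1.

Lemma pi_reprP x : normal_closure A ((repr (\pi_(quo A) x))^-1 * x).
Proof. by apply/quoP; rewrite reprK. Qed.

Lemma quo_mulE x y : quo_mul (\pi_(quo A) x) (\pi_(quo A) y) = \pi_(quo A) (x * y).
Proof.
apply/eqP/quoP; set x' := repr _; set y' := repr _.
have -> : (x' * y')^-1 * (x * y) = (x'^-1 * x) ^ y' * (y'^-1 * y).
  by rewrite conjgE invgM !mulgA mulgK.
by apply: gen_M; [apply: normal_closureJ|]; apply: pi_reprP.
Qed.

Lemma quo_invE x : quo_inv (\pi_(quo A) x) = \pi_(quo A) x^-1.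
Proof.
apply/eqP/quoP; set x' := repr _; rewrite invgK.
have -> : x' * x^-1 = ((x'^-1 * x)^-1) ^ x'^-1.
  by rewrite conjgE invgM !invgK !mulgA mulgK.
by apply: normal_closureJ; apply: gen_V; apply: pi_reprP.
Qed.

Lemma quo_mulA : associative quo_mul.
Proof.
elim/quotW=> a; elim/quotW=> b; elim/quotW=> c.
by rewrite (quo_mulE b c) (quo_mulE a) (quo_mulE a b) quo_mulE mulgA.
Qed.

Lemma quo_mul1 : left_id quo_one quo_mul.
Proof. by elim/quotW=> a; rewrite quo_mulE mul1g. Qed.

Lemma quo_mulr1 : right_id quo_one quo_mul.
Proof. by elim/quotW=> a; rewrite quo_mulE mulg1. Qed.

Lemma quo_mulV : left_inverse quo_one quo_inv quo_mul.
Proof. by elim/quotW=> a; rewrite quo_invE quo_mulE mulVg. Qed.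

Lemma quo_mulrV : right_inverse quo_one quo_inv quo_mul.
Proof. by elim/quotW=> a; rewrite quo_invE quo_mulE mulgV. Qed.

HB.instance Definition _ := isGroup.Build (quo A)
  quo_mulA quo_mul1 quo_mulr1 quo_mulV quo_mulrV.

Lemma pi_quoM : {morph \pi_(quo A) : x y / x * y >-> x * y}.
Proof. by move=> x y; rewrite -quo_mulE. Qed.

End QuoGroup.
End GroupGeneralities.

Section Presentation.
Variable I : choiceType.

(* The letter (i, false) stands for the generator i, (i, true) for its
   inverse. *)
Definition word := seq (I * bool).

Definition letter_inv (l : I * bool) : I * bool := (l.1, ~~ l.2).

Definition word_inv (w : word) : word := rev (map letter_inv w).

Variable R : set (word * word).

Inductive pres_eq : word -> word -> Prop :=
| pres_rel u v of R (u, v) : pres_eq u v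
| pres_cancel l : pres_eq [:: l; letter_inv l] [::]
| pres_cat u u' v v' of pres_eq u u' & pres_eq v v' :
    pres_eq (u ++ v) (u' ++ v')
| pres_refl u : pres_eq u u
| pres_sym u v of pres_eq u v : pres_eq v u
| pres_trans u v w of pres_eq u v & pres_eq v w : pres_eq u w.

Definition pres_eqb : rel word := fun u v => `[< pres_eq u v >].

Lemma pres_eqb_equiv : equiv_class_of pres_eqb.
Proof.
split=> [x|x y|y x z].
- exact/asboolP/pres_refl.
- by apply/asboolP/asboolP; apply: pres_sym.
- move=> /asboolP hxy /asboolP hyz; apply/asboolP; exact: pres_trans hxy hyz.
Qed.

Canonical pres_equiv := EquivRelPack pres_eqb_equiv.

(* The group with generators I and relations u = v for (u, v) in R. *)
Definition pres : Type := {eq_quot pres_eqb}.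

HB.instance Definition _ := Choice.on pres.
HB.instance Definition _ := EqQuotient.on pres.

Lemma presP u v : reflect (pres_eq u v) (u == v %[mod pres]).
Proof. by rewrite eqmodE; apply: (iffP idP) => /asboolP. Qed.

Lemma pres_reprP u : pres_eq (repr (\pi_pres u)) u.
Proof. by apply/presP; rewrite reprK. Qed.

Lemma letter_invK : involutive letter_inv.
Proof. by case=> i b; rewrite /letter_inv /= negbK. Qed.

Lemma word_invK : involutive word_inv.
Proof. by move=> u; rewrite /word_inv map_rev revK mapK //; apply: letter_invK. Qed.

Lemma word_invV u : pres_eq (u ++ word_inv u) [::].
Proof.
elim: u => [|l u IHu]; first exact: pres_refl.
rewrite /word_inv /= rev_cons -cats1 catA -[l :: _]cat1s -/(word_inv u).
apply: (pres_trans (v := [:: l] ++ [:: letter_inv l])); last exact: pres_cancel.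
apply: pres_cat; first exact: pres_refl.
by apply: (@pres_cat _ [::]); last exact: pres_refl.
Qed.

Lemma word_Vinv u : pres_eq (word_inv u ++ u) [::].
Proof. by have := word_invV (word_inv u); rewrite word_invK. Qed.

Lemma word_inv_eq u v : pres_eq u v -> pres_eq (word_inv u) (word_inv v).
Proof.
move=> uv; have h1 : pres_eq (word_inv u ++ v ++ word_inv v) (word_inv u).
  rewrite -[X in pres_eq _ X]cats0; apply: pres_cat; first exact: pres_refl.
  exact: word_invV.
apply: (pres_trans (pres_sym h1)); rewrite catA.
apply: (@pres_cat _ [::]); last exact: pres_refl.
apply: (pres_trans (v := word_inv u ++ u)); last exact: word_Vinv.
by apply: pres_cat; [exact: pres_refl | exact: pres_sym].
Qed.

Definition pres_mul (a b : pres) : pres := \pi_pres (repr a ++ repr b).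
Definition pres_inv (a : pres) : pres := \pi_pres (word_inv (repr a)).
Definition pres_one : pres := \pi_pres [::].

Lemma pres_mulE u v : pres_mul (\pi_pres u) (\pi_pres v) = \pi_pres (u ++ v).
Proof. by apply/eqP/presP; apply: pres_cat; apply: pres_reprP. Qed.

Lemma pres_invE u : pres_inv (\pi_pres u) = \pi_pres (word_inv u).
Proof. by apply/eqP/presP; apply: word_inv_eq; apply: pres_reprP. Qed.

Lemma pres_mulA : associative pres_mul.
Proof.
elim/quotW=> a; elim/quotW=> b; elim/quotW=> c.
by rewrite (pres_mulE b c) (pres_mulE a) (pres_mulE a b) pres_mulE catA.
Qed.

Lemma pres_mul1 : left_id pres_one pres_mul.
Proof. by elim/quotW=> a; rewrite pres_mulE. Qed.

Lemma pres_mulr1 : right_id pres_one pres_mul.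
Proof. by elim/quotW=> a; rewrite pres_mulE cats0. Qed.

Lemma pres_mulV : left_inverse pres_one pres_inv pres_mul.
Proof.
elim/quotW=> a; rewrite pres_invE pres_mulE.
by apply/eqP/presP; apply: word_Vinv.
Qed.

Lemma pres_mulrV : right_inverse pres_one pres_inv pres_mul.
Proof.
elim/quotW=> a; rewrite pres_invE pres_mulE.
by apply/eqP/presP; apply: word_invV.
Qed.

HB.instance Definition _ := isGroup.Build pres
  pres_mulA pres_mul1 pres_mulr1 pres_mulV pres_mulrV.

Definition pgen (i : I) : pres := \pi_pres [:: (i, false)].

Lemma pi_presM u v : \pi_pres u * \pi_pres v = \pi_pres (u ++ v).
Proof. exact: pres_mulE. Qed.

Section Lift.
Variables (H : groupType) (h : I -> H).

Definition letter_eval (l : I * bool) : H := if l.2 then (h l.1)^-1 else h l.1.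
Definition word_eval (w : word) : H := foldr (fun l x => letter_eval l * x) 1 w.

Lemma word_eval_cat u v : word_eval (u ++ v) = word_eval u * word_eval v.
Proof. by elim: u => [|l u IHu] /=; rewrite ?mul1g // IHu mulgA. Qed.

Hypothesis hR : forall u v, R (u, v) -> word_eval u = word_eval v.

Lemma word_eval_eq u v : pres_eq u v -> word_eval u = word_eval v.
Proof.
elim=> {u v} [u v /hR//|[i []]|u u' v v' _ IHu _ IHv|//|//|u v w _ -> _ ->//].
- by rewrite /= /letter_eval /= mulg1 mulVg.
- by rewrite /= /letter_eval /= mulg1 mulgV.
- by rewrite !word_eval_cat IHu IHv.
Qed.

(* The homomorphism pres -> H with pgen i |-> h i. *)
Definition pres_lift (a : pres) : H := word_eval (repr a).

Lemma pres_lift_pi u : pres_lift (\pi_pres u) = word_eval u.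
Proof. exact/word_eval_eq/pres_reprP. Qed.

Lemma pres_liftM : {morph pres_lift : a b / a * b}.
Proof.
elim/quotW=> a; elim/quotW=> b; rewrite pi_presM !pres_lift_pi.
exact: word_eval_cat.
Qed.

Lemma pres_lift_morphism : monoid_morphism pres_lift.
Proof. by split; [exact: pres_lift_pi | exact: pres_liftM]. Qed.

Lemma pres_lift_gen i : pres_lift (pgen i) = h i.
Proof. by rewrite pres_lift_pi /= /letter_eval /= mulg1. Qed.

End Lift.
End Presentation.


(* The generators false and true are sigma_1 and sigma_2. *)
Definition braid_relation : set (word bool * word bool) :=
  [set ([:: (false, false); (true, false); (false, false)],
        [:: (true, false); (false, false); (true, false)])].

Definition B3 : Type := pres braid_relation.

HB.instance Definition _ := EqQuotient.on B3.
HB.instance Definition _ := Group.on B3.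

Definition sigma1 : B3 := pgen _ false.
Definition sigma2 : B3 := pgen _ true.

Definition to_S3_gen (i : bool) : 'S_3 :=
  if i then tperm (@Ordinal 3 1 isT) (@Ordinal 3 2 isT)
  else tperm (@Ordinal 3 0 isT) (@Ordinal 3 1 isT).

Definition to_S3 : B3 -> 'S_3 := @pres_lift _ _ _ to_S3_gen.

Lemma to_S3_gen_braid u v : braid_relation (u, v) ->
  word_eval to_S3_gen u = word_eval to_S3_gen v.
Proof.
case=> -> ->; rewrite /= /letter_eval /= !mulg1.
apply/permP => -[[|[|[|//]]] hk]; rewrite !permM !permE /=; exact: val_inj.
Qed.

HB.instance Definition _ := isUMagmaMorphism.Build B3 'S_3 to_S3
  (pres_lift_morphism to_S3_gen_braid).

Definition PB3 : Type := {g : B3 | to_S3 g == 1}.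

Lemma PB3_closed : group_closed (fun g : B3 => to_S3 g == 1).
Proof.
split; first by rewrite unfold_in gmulf1.
move=> x y; rewrite !unfold_in => /eqP hx /eqP hy.
by rewrite gmulfF /= hx hy divgg.
Qed.

HB.instance Definition _ := SubChoice.on PB3.
HB.instance Definition _ :=
  SubChoice_isSubGroup.Build B3 (fun g => to_S3 g == 1) PB3 PB3_closed.

Lemma to_S3_sigma1 : to_S3 sigma1 = to_S3_gen false.
Proof. exact: (pres_lift_gen to_S3_gen_braid). Qed.

Lemma to_S3_sigma2 : to_S3 sigma2 = to_S3_gen true.
Proof. exact: (pres_lift_gen to_S3_gen_braid). Qed.

Fact x12_subproof : to_S3 (sigma1 ^+ 2) == 1.
Proof. by rewrite expgS expg1 gmulfM /= to_S3_sigma1 tperm2. Qed.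

Fact x23_subproof : to_S3 (sigma2 ^+ 2) == 1.
Proof. by rewrite expgS expg1 gmulfM /= to_S3_sigma2 tperm2. Qed.

Fact c_subproof : to_S3 ((sigma1 * sigma2 * sigma1) ^+ 2) == 1.
Proof.
rewrite expgS expg1 !gmulfM /= to_S3_sigma1 to_S3_sigma2.
apply/eqP/permP => -[[|[|[|//]]] hk]; rewrite !permM !permE /=; exact: val_inj.
Qed.

Definition x12 : PB3 := exist _ (sigma1 ^+ 2) x12_subproof.
Definition x23 : PB3 := exist _ (sigma2 ^+ 2) x23_subproof.
Definition braid_c : PB3 :=
  exist _ ((sigma1 * sigma2 * sigma1) ^+ 2) c_subproof.

(* The homomorphism PB3 -> H with x12 |-> a, x23 |-> b and c |-> z (z central),
   obtained from the action of B3 on (PB3-cosets) * H; the cosets have representatives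
   1, sigma1, sigma2, sigma1 sigma2, sigma2 sigma1, sigma1 sigma2 sigma1. *)
Section PB3Hom.
Variables (H : groupType) (a b z : H).
Hypothesis z_central : forall h, h * z = z * h.

Inductive coset6 := Co | Co1 | Co2 | Co12 | Co21 | Co121.

Definition coset_next (i : bool) (t : coset6) : coset6 :=
  match i, t with
  | false, Co => Co1 | false, Co1 => Co | false, Co2 => Co21
  | false, Co12 => Co121 | false, Co21 => Co2 | false, Co121 => Co12
  | true, Co => Co2 | true, Co2 => Co | true, Co1 => Co12
  | true, Co12 => Co1 | true, Co21 => Co121 | true, Co121 => Co21
  end.

Definition cocycle (i : bool) (t : coset6) : H :=
  match i, t with
  | false, Co1 => a | false, Co21 => a^-1 * b^-1 * z | false, Co121 => b
  | true, Co2 => b | true, Co12 => z * b^-1 * a^-1 | true, Co121 => a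
  | _, _ => 1
  end.

Definition letter_step (st : coset6 * H) (l : bool * bool) : coset6 * H :=
  let t := coset_next l.1 st.1 in
  (t, st.2 * (if l.2 then (cocycle l.1 t)^-1 else cocycle l.1 st.1)).

Definition run (st : coset6 * H) (w : word bool) := foldl letter_step st w.

Lemma coset_nextK i : involutive (coset_next i).
Proof. by case: i; case. Qed.

Lemma run_cancel st l : run st [:: l; letter_inv l] = st.
Proof.
case: st l => t h [i []]; rewrite /run /= /letter_step /= coset_nextK.
  by rewrite mulgVK.
by rewrite mulgK.
Qed.

Lemma run_braid st u v : braid_relation (u, v) -> run st u = run st v.
Proof.
have zc := z_central; case=> -> ->; case: st => -[] h;
  rewrite /run /= /letter_step /= ?mulg1 -?mulgA //; congr (_, h * _).
- by rewrite mulVKg mulVg mulg1 zc.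
- by rewrite -(zc b) mulKg -(zc (b^-1 * a^-1)) -!mulgA mulVKg.
- by rewrite mulVg mulg1 mulVKg -(zc b) mulKg -(zc b^-1) mulVKg.
Qed.

Lemma run_eq st u v : pres_eq braid_relation u v -> run st u = run st v.
Proof.
move=> uv; elim: uv st => {u v}.
- by move=> u v huv st; apply: run_braid.
- by move=> l st; rewrite run_cancel.
- by move=> u u' v v' _ IHu _ IHv st; rewrite /run !foldl_cat -!/(run _ _) IHu IHv.
- by [].
- by move=> u v _ IH st.
- by move=> u v w _ IHu _ IHv st; rewrite IHu.
Qed.

Lemma run_mull w t h k :
  run (t, h * k) w = ((run (t, k) w).1, h * (run (t, k) w).2).
Proof.
elim: w t k => // l w IHw t k.
have -> st : run st (l :: w) = run (letter_step st l) w by [].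
by rewrite /letter_step -mulgA IHw.
Qed.

Definition coset_perm (t : coset6) : 'S_3 :=
  match t with
  | Co => 1 | Co1 => to_S3 sigma1 | Co2 => to_S3 sigma2
  | Co12 => to_S3 (sigma1 * sigma2) | Co21 => to_S3 (sigma2 * sigma1)
  | Co121 => to_S3 (sigma1 * sigma2 * sigma1)
  end.

Lemma coset_permE i t : coset_perm (coset_next i t) = coset_perm t * to_S3_gen i.
Proof.
case: i t => -[]; rewrite /= ?gmulfM /= ?to_S3_sigma1 ?to_S3_sigma2;
  apply/permP => -[[|[|[|//]]] hk]; rewrite ?permM !permE /=; exact: val_inj.
Qed.

Lemma run_perm st w :
  coset_perm (run st w).1 = coset_perm st.1 * word_eval to_S3_gen w.
Proof.
elim: w st => [|l w IHw] st /=; first by rewrite mulg1.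
rewrite IHw /= coset_permE -mulgA; congr (_ * (_ * _)).
by case: l => i []; rewrite /letter_eval //=; case: i; rewrite tpermV.
Qed.

Lemma coset_perm_inj t : coset_perm t = 1 -> t = Co.
Proof.
have neq (s : 'S_3) (i : 'I_3) : s i != i -> s <> 1.
  by move=> + s1; rewrite s1 perm1 eqxx.
case: t => //=; rewrite ?gmulfM /= ?to_S3_sigma1 ?to_S3_sigma2 => h; exfalso.
all: move: h; first [apply: (neq _ (@Ordinal 3 0 isT)); by rewrite ?permM !permE
                    | apply: (neq _ (@Ordinal 3 1 isT)); by rewrite ?permM !permE].
Qed.

Definition PB3_map (p : PB3) : H := (run (Co, 1) (repr (val p))).2.

Lemma PB3_map_pi (p : PB3) w : val p = \pi_B3 w -> PB3_map p = (run (Co, 1) w).2.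
Proof. by rewrite /PB3_map => ->; rewrite (run_eq _ (pres_reprP _ w)). Qed.

Lemma run_PB3 (p : PB3) : (run (Co, 1) (repr (val p))).1 = Co.
Proof.
apply: coset_perm_inj; rewrite run_perm mul1g.
exact/eqP/(valP p).
Qed.

Let pi_B3M u v : \pi_B3 (u ++ v) = \pi_B3 u * \pi_B3 v.
Proof. exact/esym/pi_presM. Qed.

Lemma PB3_mapM : {morph PB3_map : p q / p * q}.
Proof.
move=> p q.
rewrite (@PB3_map_pi _ (repr (val p) ++ repr (val q))); last first.
  by rewrite pi_B3M !reprK.
rewrite /run foldl_cat -!/(run _ _) (surjective_pairing (run _ (repr (val p)))).
by rewrite run_PB3 -/(PB3_map p) -[PB3_map p in LHS]mulg1 run_mull.
Qed.

Lemma PB3_map_x12 : PB3_map x12 = a.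
Proof.
rewrite (@PB3_map_pi _ [:: (false, false); (false, false)]).
  by rewrite /= !mul1g.
by rewrite /= expgS expg1 [LHS]pi_presM.
Qed.

Lemma PB3_map_x23 : PB3_map x23 = b.
Proof.
rewrite (@PB3_map_pi _ [:: (true, false); (true, false)]).
  by rewrite /= !mul1g.
by rewrite /= expgS expg1 [LHS]pi_presM.
Qed.

Lemma PB3_map_c : PB3_map braid_c = z.
Proof.
rewrite (@PB3_map_pi _ [:: (false, false); (true, false); (false, false);
    (false, false); (true, false); (false, false)]).
  by rewrite /= !mul1g !mulgA mulgVK z_central mulgK.
have s1E : sigma1 = \pi_B3 [:: (false, false)] by [].
have s2E : sigma2 = \pi_B3 [:: (true, false)] by [].
by rewrite -[LHS]/((sigma1 * sigma2 * sigma1) ^+ 2) expgS expg1 s1E s2E -!pi_B3M.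
Qed.

End PB3Hom.

Definition F2 : Type := gp [set g : PB3 | g = x12 \/ g = x23].

HB.instance Definition _ := SubChoice.on F2.
HB.instance Definition _ := SubGroup.on F2.

Fact x_subproof : x12 \in gen [set g : PB3 | g = x12 \/ g = x23].
Proof. by rewrite inE; apply: gen_in; left. Qed.

Fact y_subproof : x23 \in gen [set g : PB3 | g = x12 \/ g = x23].
Proof. by rewrite inE; apply: gen_in; right. Qed.

Definition xF2 : F2 := exist _ x12 x_subproof.
Definition yF2 : F2 := exist _ x23 y_subproof.

Definition PB3_to_B3 (p : PB3) : B3 := val p.
Definition F2_to_PB3 (f : F2) : PB3 := val f.
Coercion PB3_to_B3 : PB3 >-> B3.
Coercion F2_to_PB3 : F2 >-> PB3.

(* The endomorphism of F2 with x |-> u and y |-> v. *)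
Definition F2_endo (u v : F2) (f : F2) : F2 := PB3_map u v 1 f.

Lemma F2_endoM u v : {morph F2_endo u v : f g / f * g}.
Proof. by move=> f g; apply: PB3_mapM => h; rewrite mulg1 mul1g. Qed.

HB.instance Definition _ u v := isMultiplicative.Build F2 F2 (F2_endo u v)
  (F2_endoM u v).

Lemma F2_endo_x u v : F2_endo u v xF2 = u.
Proof. by apply: PB3_map_x12 => h; rewrite mulg1 mul1g. Qed.

Lemma F2_endo_y u v : F2_endo u v yF2 = v.
Proof. by apply: PB3_map_x23 => h; rewrite mulg1 mul1g. Qed.

(* Z/n for n : nat; Zmod 0 is Z and Zmod 1 is trivial, unlike 'Z_0 and 'Z_1. *)
Definition Zmod_rel (n : nat) : rel int := fun a b => (a == b %[mod n])%Z.

Lemma Zmod_rel_equiv n : equiv_class_of (Zmod_rel n).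
Proof.
split=> [a|a b|b a d]; rewrite /Zmod_rel ?eqxx // 1?eq_sym //.
by move=> /eqP -> /eqP ->.
Qed.

Canonical Zmod_equiv n := EquivRelPack (Zmod_rel_equiv n).

Definition Zmod (n : nat) : Type := {eq_quot Zmod_rel n}.

HB.instance Definition _ n := EqQuotient.on (Zmod n).

(* The sets N below are meant to be finite index normal subgroups of B3
   contained in PB3. *)
Definition N_PB3 (N : set B3) : set PB3 := [set p : PB3 | N p].
Definition N_F2 (N : set B3) : set F2 := [set f : F2 | N f].

Definition N_ord (N : set B3) : nat :=
  let o (p : PB3) := gorder (\pi_(quo (N_PB3 N)) p) in
  lcmn (lcmn (o x12) (o x23)) (o braid_c).

Definition GT_pair (N : set B3) : Type := (Zmod (N_ord N) * quo (N_F2 N))%type.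

Definition GT_class (N : set B3) (m : int) (f : F2) : GT_pair N :=
  (\pi_(Zmod (N_ord N)) m, \pi_(quo (N_F2 N)) f).

Definition twice1 (m : int) : int := (2 * m + 1)%R.

Definition hexagon1 (N : set B3) (m : int) (f : F2) : Prop :=
  \pi_(quo N) (expgz sigma1 (twice1 m) * (f : B3)^-1 *
               expgz sigma2 (twice1 m) * (f : B3))
  = \pi_(quo N) ((f : B3)^-1 * sigma1 * sigma2 *
                 expgz (x12 : B3) (- m)%R * expgz (braid_c : B3) m).

Definition hexagon2 (N : set B3) (m : int) (f : F2) : Prop :=
  \pi_(quo N) ((f : B3)^-1 * expgz sigma2 (twice1 m) * (f : B3) *
               expgz sigma1 (twice1 m))
  = \pi_(quo N) (sigma2 * sigma1 * expgz (x23 : B3) (- m)%R *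
                 expgz (braid_c : B3) m * (f : B3)).

(* T_{m,f}, which is determined by its values on the generators. *)
Definition is_T (N : set B3) (m : int) (f : F2)
    (T : {multiplicative B3 -> quo N}) : Prop :=
  T sigma1 = \pi_(quo N) (expgz sigma1 (twice1 m)) /\
  T sigma2 = \pi_(quo N) ((f : B3)^-1 * expgz sigma2 (twice1 m) * (f : B3)).

Definition is_GT_shadow (N : set B3) (m : int) (f : F2) : Prop :=
  [/\ hexagon1 N m f /\ hexagon2 N m f,
      gcdz (twice1 m) (N_ord N) = 1%R,
      commutator_subgroup (\pi_(quo (N_F2 N)) f)
    & exists T : {multiplicative B3 -> quo N},
        is_T m f T /\ forall q : quo N, exists g : B3, T g = q].

Definition GT (N : set B3) : set (GT_pair N) :=
  [set s | exists m f, is_GT_shadow N m f /\ s = GT_class N m f].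

Arguments GT N _ : clear implicits.

Definition E_endo (m : int) (f : F2) : {multiplicative F2 -> F2} :=
  F2_endo (expgz xF2 (twice1 m)) (f^-1 * expgz yF2 (twice1 m) * f).

Definition GT_comp_m (m1 m2 : int) : int := (2 * m1 * m2 + m1 + m2)%R.

Definition GT_comp_f (m1 : int) (f1 f2 : F2) : F2 := f1 * E_endo m1 f1 f2.

(* GT(N), with [m1, f1] o [m2, f2] = [2 m1 m2 + m1 + m2, f1 E_{m1,f1}(f2)], is
   isomorphic to G. The composition law is required to be compatible with phi
   for all representatives of the classes, and to stay in GT(N). *)
Definition GT_isog (N : set B3) (G : groupType) : Prop :=
  exists phi : GT_pair N -> G,
    set_bij (GT N) setT phi /\
    forall m1 f1 m2 f2, GT N (GT_class N m1 f1) -> GT N (GT_class N m2 f2) ->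
      let s := GT_class N (GT_comp_m m1 m2) (GT_comp_f m1 f1 f2) in
      GT N s /\ phi s = phi (GT_class N m1 f1) * phi (GT_class N m2 f2).

(* The generators false and true are r and s. *)
Definition dihedral_relation (n : nat) : set (word bool * word bool) :=
  [set p | [\/ p = (nseq n (false, false), [::]),
               p = ([:: (true, false); (true, false)], [::])
             | p = ([:: (true, false); (false, false); (true, true);
                        (false, false)], [::])]].

Definition Dn (n : nat) : Type := pres (dihedral_relation n).

HB.instance Definition _ n := Group.on (Dn n).

Definition dih_r n : Dn n := pgen _ false.
Definition dih_s n : Dn n := pgen _ true.

(* The homomorphism psi_n : PB3 -> Dn ^ 3 with the values psi_x12, psi_x23 and
   psi_c below. *)
Definition psi (n : nat) : PB3 -> Dn n * Dn n * Dn n :=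
  let r := dih_r n in let s := dih_s n in
  PB3_map (r, s, s) (r * s, r, r * s) 1.

Lemma psiM n : {morph psi n : p q / p * q}.
Proof. by apply: PB3_mapM => h; rewrite mulg1 mul1g. Qed.

HB.instance Definition _ n :=
  isMultiplicative.Build PB3 (Dn n * Dn n * Dn n)%type (psi n) (@psiM n).

Lemma psi_x12 n : psi n x12 = (dih_r n, dih_s n, dih_s n).
Proof. by apply: PB3_map_x12 => h; rewrite mulg1 mul1g. Qed.

Lemma psi_x23 n :
  psi n x23 = (dih_r n * dih_s n, dih_r n, dih_r n * dih_s n).
Proof. by apply: PB3_map_x23 => h; rewrite mulg1 mul1g. Qed.

Lemma psi_c n : psi n braid_c = 1.
Proof. by apply: PB3_map_c => h; rewrite mulg1 mul1g. Qed.

Definition Kn (n : nat) : set B3 :=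
  [set g : B3 | exists p : PB3, g = (p : B3) /\ psi n p = 1].

Local Close Scope quotient_scope.

(* Z/n x| (Z/q)^x for n %| q, on canonical residues. *)
Section Semidirect.
Variables (n q : nat).

Definition sd_carrier : Type := {p : 'I_n * 'I_q | coprime p.2 q}.

HB.instance Definition _ := SubFinite.on sd_carrier.

Definition sd_k (p : sd_carrier) : nat := (val p).1.
Definition sd_u (p : sd_carrier) : nat := (val p).2.

Definition semidirect of (0 < q)%N & n %| q : Type := sd_carrier.

Variables (q_gt0 : (0 < q)%N) (n_q : n %| q).
Local Notation sd := (semidirect q_gt0 n_q).

HB.instance Definition _ := SubFinite.on sd.

Let n_gt0 : (0 < n)%N := dvdn_gt0 q_gt0 n_q.

Lemma sd_uP (p : sd) : coprime (sd_u p) q.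
Proof. exact: (valP p). Qed.

Fact sd_subproof k u : coprime u q ->
  coprime (Ordinal (ltn_pmod k n_gt0), Ordinal (ltn_pmod u q_gt0)).2 q.
Proof. by rewrite /= coprime_modl. Qed.

Definition sd_mk k u (hu : coprime u q) : sd :=
  exist _ (Ordinal (ltn_pmod k n_gt0), Ordinal (ltn_pmod u q_gt0))
    (sd_subproof k hu).

Fact sd_mul_subproof (p1 p2 : sd) : coprime (sd_u p1 * sd_u p2)%N q.
Proof. by rewrite coprimeMl !sd_uP. Qed.

Fact sd_one_subproof : coprime 1 q.
Proof. exact: coprime1n. Qed.

Fact sd_inv_subproof (p : sd) : coprime (sd_u p ^ (totient q).-1)%N q.
Proof. by rewrite coprimeXl // sd_uP. Qed.

Definition sd_mul (p1 p2 : sd) : sd :=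
  sd_mk (sd_k p1 + sd_u p1 * sd_k p2)%N (sd_mul_subproof p1 p2).

Definition sd_one : sd := sd_mk 0 sd_one_subproof.

Definition sd_inv (p : sd) : sd :=
  sd_mk (n.-1 * (sd_u p ^ (totient q).-1 * sd_k p))%N (sd_inv_subproof p).

Lemma sd_eq (p1 p2 : sd) :
  sd_k p1 = sd_k p2 %[mod n] -> sd_u p1 = sd_u p2 %[mod q] -> p1 = p2.
Proof.
move: p1 p2 => [[k1 u1] h1] [[k2 u2] h2]; rewrite /sd_k /sd_u /=.
rewrite !modn_small // => hk hu; apply: val_inj => /=.
by congr (_, _); apply: ord_inj.
Qed.

Lemma sd_mulA : associative sd_mul.
Proof.
move=> p1 p2 p3; apply: sd_eq; rewrite /sd_k /sd_u /= -?/(sd_k _) -?/(sd_u _).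
  rewrite !modn_mod -modnDmr modnMmr modnDmr modnDml.
  rewrite -[in RHS]modnDmr -[in RHS]modnMml (modn_dvdm _ n_q) modnMml modnDmr.
  by rewrite mulnDr addnA mulnA.
by rewrite !modn_mod modnMmr modnMml mulnA.
Qed.

Lemma sd_mul1 : left_id sd_one sd_mul.
Proof.
move=> p; apply: sd_eq; rewrite /sd_k /sd_u /= /sd_k /sd_u /=.
  by rewrite modn_mod mod0n add0n -modnMml (modn_dvdm _ n_q) modnMml mul1n.
by rewrite modn_mod modnMml mul1n.
Qed.

Lemma sd_mulV : left_inverse sd_one sd_inv sd_mul.
Proof.
move=> p; apply: sd_eq; rewrite /sd_k /sd_u /= /sd_k /sd_u /=.
  rewrite !modn_mod modnDml -modnDmr -[in LHS]modnMml (modn_dvdm _ n_q).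
  by rewrite modnMml modnDmr -mulSnr prednK // modnMr mod0n.
rewrite !modn_mod modnMml -expnSr prednK ?totient_gt0 //.
exact: Euler_exp_totient (sd_uP p).
Qed.

HB.instance Definition _ := Finite_isGroup.Build sd sd_mulA sd_mul1 sd_mulV.

End Semidirect.

Definition Aff (n : nat) (n_gt0 : (0 < n)%N) : Type :=
  semidirect n_gt0 (dvdnn n).

HB.instance Definition _ n n_gt0 := FinGroup.on (@Aff n n_gt0).

Fact pow2_gt0 k : (0 < 2 ^ k)%N.
Proof. by rewrite expn_gt0. Qed.

Fact pow2_dvd a : 2 ^ (a - 1) %| 2 ^ (a + 1).
Proof. by apply: dvdn_exp2l; lia. Qed.

(* Only meaningful for 2 <= a: a - 1 is truncated subtraction. *)
Definition semidirect2 (a : nat) : Type :=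
  semidirect (pow2_gt0 (a + 1)) (pow2_dvd a).

HB.instance Definition _ a := FinGroup.on (semidirect2 a).

Definition Htilde_set (alpha : nat) : {set semidirect2 alpha} :=
  [set p : semidirect2 alpha | `[< exists a b : nat,
     (Posz (sd_u p) = (-1) ^+ a * 5 ^+ b %[mod Posz (2 ^ (alpha + 1))%N])%Z /\
     sd_k p = b %[mod 2] >]]%SET.

Lemma Htilde_group_set alpha : group_set (Htilde_set alpha).
Proof.
apply/group_setP; split=> [|p1 p2].
  rewrite inE; apply/asboolP; exists 0%N, 0%N.
  rewrite /sd_k /sd_u /= -modz_nat modz_mod mod0n.
  by split.
rewrite !inE => -[a1 [b1 [u1 k1]]] [a2 [b2 [u2 k2]]].
exists (a1 + a2)%N, (b1 + b2)%N; split.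
  rewrite [sd_u (p1 * p2)]/((sd_u p1 * sd_u p2) %% 2 ^ (alpha + 1))%N.
  rewrite -modz_nat modz_mod PoszM.
  by rewrite -modzMm u1 u2 modzMm !GRing.exprD GRing.mulrACA.
have -> : sd_k (p1 * p2) = ((sd_k p1 + sd_u p1 * sd_k p2) %% 2 ^ (alpha - 1))%N.
  by [].
case: (leqP alpha 1) => [alpha_le1|alpha_gt1].
  have n1 : (2 ^ (alpha - 1) = 1)%N by have -> : (alpha - 1 = 0)%N by lia.
  have k0 (p : semidirect2 alpha) : sd_k p = 0%N.
    by have := ltn_ord (val p).1; rewrite [X in (_ < X)%N]n1 ltnS leqn0 => /eqP.
  by move: k1 k2; rewrite !k0 muln0 addn0 !mod0n -modnDm => <- <-.
have d2 : 2 %| 2 ^ (alpha - 1) by rewrite dvdn_exp // subn_gt0.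
rewrite modn_dvdm // -modnDm -modnMm k2.
have -> : (sd_u p1 %% 2 = 1)%N.
  have : coprime (sd_u p1) (2 ^ (alpha + 1)) := valP p1.
  by rewrite coprime_pexpr ?addn1 // coprimen2 modn2 => ->.
by rewrite mul1n modn_mod k1 modnDm.
Qed.

Canonical Htilde alpha := Group (Htilde_group_set alpha).

(* Main.v *)
(** B3 acts on R^3, R = Z/2n, by affine maps whose linear parts are signed
    permutations. On PB3 this is the coordinatewise action of Dn^3 through psi
    (r acts on R as the translation by 2, s as negation), so Kn n is its kernel.
    The commutator subgroup of F2 acts by the translations 4(a, b, c) with
    a = b = c mod 2. With u = 2m+1 and e = (-1)^m, the hexagon relations for
    f acting as the translation by w say w3 = 1 - e u and w1 + w2 = 0; T_{m,f}
    is then conjugation by an affine map with linear part diag(u, u, e u), hence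
    surjective by finiteness. A shadow is thus a pair (u, a), with w1 = 4a and
    a = (1 - e u)/4 mod 2, and composition is (u u', a + u a'). The Chinese
    remainder theorem splits off the odd part of n, and on the 2-part the parity
    condition reads a = b mod 2 when u = +-5^b. *)
From HB Require Import structures.
Require Import Defs.
From mathcomp Require Import all_boot all_order all_fingroup all_algebra.
From mathcomp Require Import generic_quotient boolp classical_sets functions.
From mathcomp Require Import zify ring.

Set Implicit Arguments.
Unset Strict Implicit.
Unset Printing Implicit Defensive.

Import GRing.Theory Order.TTheory Num.Theory.
Import GroupScope.
Local Open Scope quotient_scope.
Local Open Scope group_scope.

(** The coefficients are taken modulo 2n rather than n because sigma_1 has to act as a square root
    of x12: once r is the translation by 2, the translation by 1 is half of it, and the two sign
    changes form the square of a quarter turn. With all of B3 acting, an equality modulo [Kn n]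
    becomes an equality of permutations that can be tested at points. The obstacle is that a is an
    integer known only through 4a modulo 2n, while its parity is constrained; and m is known only
    modulo lcm(n, 2). The isomorphisms are therefore described as relations between integer pairs
    (m, a) and group elements. At the prime 2 the class of m amounts to u modulo 2^(alpha+1) when
    alpha >= 1 and modulo 4 when alpha = 0, and 4a modulo 2^(alpha+1) amounts to a modulo
    2^(alpha-1) when alpha >= 2 and to nothing otherwise. This explains both exponents in
    [semidirect2] and the factor of order 2 for small alpha. The parity condition comes from 5^b = 1
    + 4b modulo 8, where e u is the one of u and -u that is 1 modulo 4. *)

Section IntPowers.
Variable G : groupType.
Implicit Types x y : G.

Lemma invg_uniq x y : x * y = 1 -> x^-1 = y.
Proof. by move=> xy; apply: (mulgI x); rewrite mulgV xy. Qed.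

(** Cancelling [x] runs the recursion downwards as well, so a closed formula for integer powers has
    to be checked only at 0 and for one step up. *)
Lemma expgz_uniq x (F : int -> G) :
  F 0%R = 1 -> (forall m, F (m + 1)%R = F m * x) -> forall m, F m = expgz x m.
Proof.
move=> F0 FS [k|k] /=; first by elim: k => // k IH; rewrite -addn1 PoszD FS IH addn1 expgSr.
elim: k => [|k IH].
  by apply: (mulIg x); rewrite -FS expg1 mulVg -F0.
apply: (mulIg x); rewrite -FS expgS invMg mulgVK -IH.
by congr F; lia.
Qed.

Lemma expgzS x m : expgz x (m + 1)%R = expgz x m * x.
Proof.
case: m => [k|[|k]].
- by rewrite -PoszD addn1 /= expgSr.
- by rewrite /= expg1 mulVg.
- have -> : (Negz k.+1 + 1)%R = Negz k by lia.
  by rewrite /= (expgS x k.+1) invMg mulgVK.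
Qed.

Lemma expgz_twice1 x m : expgz x (twice1 m) = expgz (x ^+ 2) m * x.
Proof.
rewrite /twice1 expgzS; congr (_ * _).
apply: (@expgz_uniq (x ^+ 2) (fun m => expgz x (2 * m)%R)) => // k.
have -> : (2 * (k + 1) = 2 * k + 1 + 1)%R by lia.
by rewrite !expgzS expgS expg1 mulgA.
Qed.

Lemma expgz_conj x y m : expgz (x ^ y) m = (expgz x m) ^ y.
Proof.
symmetry; apply: (@expgz_uniq _ (fun m => (expgz x m) ^ y)) => [|k].
  by rewrite conj1g.
by rewrite expgzS conjMg.
Qed.

Lemma expgz_sqr x m : expgz (x ^+ 2) m = expgz x m ^+ 2.
Proof.
have xx : x ^ x = x by rewrite conjgE mulKg.
have comm k : x * expgz x k = expgz x k * x by rewrite (conjgC (expgz x k)) -expgz_conj xx.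
symmetry; move: m; apply: expgz_uniq => [|m]; first by rewrite expg1n.
by rewrite expgzS expgMn //; exact: esym (comm m).
Qed.

Lemma gorder_eq x k : (0 < k)%N ->
  (forall j, x ^+ j = 1 <-> (k %| j)%N) -> gorder x = k.
Proof.
move=> k0 xk; rewrite /gorder; case: xgetP => [j _ [j0 xj jmin]|noj].
  have jk := jmin k k0 (proj2 (xk k) (dvdnn k)).
  by have kj := dvdn_leq j0 (proj1 (xk j) xj); apply/eqP; rewrite eqn_leq jk.
case: (noj k); split=> // [|j j0 /xk kj]; first exact/xk.
exact: dvdn_leq.
Qed.

End IntPowers.

Lemma expgz_morph (G H : groupType) (f : G -> H) :
  {morph f : a b / a * b} -> forall x m, f (expgz x m) = expgz (f x) m.
Proof.
move=> fM x m; apply: (@expgz_uniq _ _ (fun m => f (expgz x m))) => [|k].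
  by apply: (mulgI (f 1)); rewrite /= -fM !mulg1.
by rewrite expgzS fM.
Qed.

Section Morphisms.
Variables (G H : groupType) (f : G -> H).
Hypothesis fM : {morph f : a b / a * b}.

Lemma morph_mul1 : f 1 = 1.
Proof. by apply: (mulgI (f 1)); rewrite -fM !mulg1. Qed.

Lemma morph_mulV a : f a^-1 = (f a)^-1.
Proof. by apply/esym/invg_uniq; rewrite -fM mulgV morph_mul1. Qed.

Lemma morph_conj a b : f (a ^ b) = f a ^ f b.
Proof. by rewrite !conjgE !fM morph_mulV. Qed.

Lemma morph_comm a b : f [~ a, b] = [~ f a, f b].
Proof. by rewrite !commgEl fM morph_mulV morph_conj. Qed.

Lemma morph_expg a k : f (a ^+ k) = f a ^+ k.
Proof. by elim: k => [|k IH]; rewrite ?morph_mul1 // !expgS fM IH. Qed.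

End Morphisms.

Lemma gen_expgz (G : groupType) (A : set G) x m : gen A x -> gen A (expgz x m).
Proof.
move=> Ax; have AX k : gen A (x ^+ k).
  by elim: k => [|k IH]; [exact: gen_1|rewrite expgS; exact: gen_M].
by case: m => k /=; [exact: AX|exact/gen_V/AX].
Qed.

Definition sgnz (R : pzRingType) (m : int) : R := ((-1) ^+ `|m|%N)%R.

Lemma sgnzS (R : pzRingType) m : sgnz R (m + 1) = (- sgnz R m)%R.
Proof.
rewrite -(mulN1r (sgnz R m)) /sgnz -exprS -[LHS]signr_odd -[RHS]signr_odd.
by congr (_ ^+ _)%R; congr nat_of_bool; lia.
Qed.

Lemma sgnzD (R : comPzRingType) m k : sgnz R (m + k) = (sgnz R m * sgnz R k)%R.
Proof.
rewrite /sgnz -exprD -[LHS]signr_odd -[RHS]signr_odd.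
by congr (_ ^+ _)%R; congr nat_of_bool; lia.
Qed.

Lemma sgnz_sq (R : comPzRingType) m : (sgnz R m * sgnz R m = 1)%R.
Proof. by rewrite -expr2 sqrr_sign. Qed.

Lemma sgnzN (R : pzRingType) m : sgnz R (- m) = sgnz R m.
Proof. by rewrite /sgnz abszN. Qed.

Lemma sgnz_pm (R : pzRingType) m : sgnz R m = 1%R \/ sgnz R m = (-1)%R.
Proof. by rewrite /sgnz -signr_odd; case: odd; [right|left]; rewrite ?expr1 ?expr0. Qed.

(** * Affine permutations for the braid generators; hexagons for translations *)

Section BraidPerms.
Variable R : finComNzRingType.
Local Notation V := (R * R * R)%type.

(** A square root of the action (r, s, s) of x12: half the rotation step on the first coordinate, a
    quarter turn about 0 on the other two. *)
Lemma s1_subproof : injective (fun v : V => (v.1.1 + 1, v.2, - v.1.2)%R).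
Proof.
apply: (can_inj (g := fun v : V => (v.1.1 - 1, - v.2, v.1.2)%R)) => -[[a b] c] /=.
by rewrite addrK opprK.
Qed.

(** A square root of the action (rs, r, rs) of x23. Composed from left to right, rs sends v to -2 -
    v, so the quarter turn of the outer coordinates is centred at -1. *)
Lemma s2_subproof : injective (fun v : V => (-2 - v.2, v.1.2 + 1, v.1.1)%R).
Proof.
apply: (can_inj (g := fun v : V => (v.2, v.1.2 - 1, -2 - v.1.1)%R)) => -[[a b] c] /=.
by congr (_, _, _); ring.
Qed.

Lemma tau_subproof (w : V) : injective (fun v : V => (v.1.1 + w.1.1, v.1.2 + w.1.2, v.2 + w.2)%R).
Proof.
apply: (can_inj (g := fun v : V => (v.1.1 - w.1.1, v.1.2 - w.1.2, v.2 - w.2)%R)) => -[[a b] c] /=.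
by rewrite !addrK.
Qed.

(* Permutations compose from left to right in MathComp. *)
Definition s1 : {perm V} := perm s1_subproof.
Definition s2 : {perm V} := perm s2_subproof.
Definition tau (w1 w2 w3 : R) : {perm V} := perm (@tau_subproof (w1, w2, w3)).

Arguments tau (w1 w2 w3)%_R.

Lemma s1E a b c : s1 (a, b, c) = (a + 1, c, - b)%R.
Proof. by rewrite permE. Qed.

Lemma s2E a b c : s2 (a, b, c) = (-2 - c, b + 1, a)%R.
Proof. by rewrite permE. Qed.

Lemma tauE w1 w2 w3 a b c : tau w1 w2 w3 (a, b, c) = (a + w1, b + w2, c + w3)%R.
Proof. by rewrite permE. Qed.

Lemma tauM w1 w2 w3 v1 v2 v3 :
  tau w1 w2 w3 * tau v1 v2 v3 = tau (w1 + v1) (w2 + v2) (w3 + v3).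
Proof. by apply/permP => -[[a b] c]; rewrite permM !tauE !addrA. Qed.

Lemma tau0 : tau 0 0 0 = 1.
Proof. by apply/permP => -[[a b] c]; rewrite tauE perm1 !addr0. Qed.

Lemma tauV w1 w2 w3 : (tau w1 w2 w3)^-1 = tau (- w1) (- w2) (- w3).
Proof. by apply/eqP; rewrite eq_invg_mul tauM !subrr tau0. Qed.

Lemma tau_inj w1 w2 w3 v1 v2 v3 : tau w1 w2 w3 = tau v1 v2 v3 ->
  [/\ w1 = v1, w2 = v2 & w3 = v3].
Proof. by move/permP => /(_ (0, 0, 0)%R); rewrite !tauE !add0r => -[-> -> ->]. Qed.

Lemma s1_s2_braid : s1 * s2 * s1 = s2 * s1 * s2.
Proof.
by apply/permP => -[[a b] c]; rewrite !permM !(s1E, s2E); congr (_, _, _); ring.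
Qed.

Lemma s1_sqE a b c : (s1 ^+ 2) (a, b, c) = (a + 2, - b, - c)%R.
Proof. by rewrite expgS expg1 permM !s1E; congr (_, _, _); ring. Qed.

Lemma s2_sqE a b c : (s2 ^+ 2) (a, b, c) = (-2 - a, b + 2, -2 - c)%R.
Proof. by rewrite expgS expg1 permM !s2E; congr (_, _, _); ring. Qed.

Lemma s1_s2_c : (s1 * s2 * s1) ^+ 2 = 1.
Proof.
apply/permP => -[[a b] c]; rewrite expgS expg1 !permM !(s1E, s2E) perm1.
by congr (_, _, _); ring.
Qed.

Lemma s1_sqzE m a b c : expgz (s1 ^+ 2) m (a, b, c) =
  (a + 2 * m%:~R, sgnz R m * b, sgnz R m * c)%R.
Proof.
(* [expgz_uniq] compares group elements, so the formula is made a permutation for each [k] before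
   the recursion is checked. *)
have inj k : injective (fun v : V =>
    (v.1.1 + 2 * k%:~R, sgnz R k * v.1.2, sgnz R k * v.2)%R).
  apply: (can_inj (g := fun v : V =>
    (v.1.1 - 2 * k%:~R, sgnz R k * v.1.2, sgnz R k * v.2)%R)) => -[[a' b'] c'] /=.
  by rewrite !mulrA sgnz_sq !mul1r addrK.
rewrite -(@expgz_uniq _ _ (fun k => perm (inj k))).
- by rewrite permE.
- by apply/permP => -[[a' b'] c']; rewrite permE perm1 /= !mul1r mulr0 addr0.
- move=> k; apply/permP => -[[a' b'] c']; rewrite permM.
  rewrite (permE (inj k)) (permE (inj (k + 1)%R)) /= s1_sqE sgnzS intrD.
  by congr (_, _, _); ring.
Qed.

Lemma s2_sqzE m a b c : expgz (s2 ^+ 2) m (a, b, c) =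
  (sgnz R m * (a + 1) - 1, b + 2 * m%:~R, sgnz R m * (c + 1) - 1)%R.
Proof.
have inj k : injective (fun v : V =>
    (sgnz R k * (v.1.1 + 1) - 1, v.1.2 + 2 * k%:~R, sgnz R k * (v.2 + 1) - 1)%R).
  apply: (can_inj (g := fun v : V =>
    (sgnz R k * (v.1.1 + 1) - 1, v.1.2 - 2 * k%:~R, sgnz R k * (v.2 + 1) - 1)%R))
    => -[[a' b'] c'] /=.
  by rewrite !subrK !mulrA sgnz_sq !mul1r !addrK.
rewrite -(@expgz_uniq _ _ (fun k => perm (inj k))).
- by rewrite permE.
- by apply/permP => -[[a' b'] c']; rewrite permE perm1 /= !mul1r mulr0 addr0 !addrK.
- move=> k; apply/permP => -[[a' b'] c']; rewrite permM.
  rewrite (permE (inj k)) (permE (inj (k + 1)%R)) /= s2_sqE sgnzS intrD.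
  by congr (_, _, _); ring.
Qed.

Lemma s1_twice1E m a b c : expgz s1 (twice1 m) (a, b, c) =
  (a + (twice1 m)%:~R, sgnz R m * c, - (sgnz R m * b))%R.
Proof.
rewrite expgz_twice1 permM s1_sqzE s1E /twice1 intrD intrM.
by congr (_, _, _); ring.
Qed.

Lemma s2_twice1E m a b c : expgz s2 (twice1 m) (a, b, c) =
  (- (sgnz R m * (c + 1)) - 1, b + (twice1 m)%:~R, sgnz R m * (a + 1) - 1)%R.
Proof.
rewrite expgz_twice1 permM s2_sqzE s2E /twice1 intrD intrM.
by congr (_, _, _); ring.
Qed.

(** The image of the origin decides: its third coordinate yields [w3], and then the first one yields
    w1 + w2 = 0. *)
Lemma hexagon1_perm m w1 w2 w3 : let f := tau w1 w2 w3 in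
  expgz s1 (twice1 m) * f^-1 * expgz s2 (twice1 m) * f
    = f^-1 * s1 * s2 * expgz (s1 ^+ 2) (- m)%R
  <-> (w3 = 1 - sgnz R m * (twice1 m)%:~R /\ w1 + w2 = 0)%R.
Proof.
move=> f; split=> [/permP /(_ (0, 0, 0)%R)|[w3E /eqP]]; rewrite /f {f}.
  rewrite !permM !tauV s1_twice1E !tauE s2_twice1E !tauE s1E s2E s1_sqzE sgnzN.
  rewrite /twice1 intrD intrM mulrNz; case=> h1 _ /eqP.
  rewrite -subr_eq0 => /eqP h3.
  have w3E : w3 = (1 - sgnz R m * (2%:~R * m%:~R + 1%:~R))%R.
    by apply/eqP; rewrite -subr_eq0 -h3; apply/eqP; ring.
  split=> //; move/eqP: h1; rewrite -subr_eq0 w3E => /eqP h1.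
  by rewrite -[RHS]h1; case: (sgnz_pm R m) => ->; ring.
rewrite addr_eq0 => /eqP ->; rewrite w3E; apply/permP => -[[a b] c].
rewrite !permM !tauV s1_twice1E !tauE s2_twice1E !tauE s1E s2E s1_sqzE sgnzN.
rewrite /twice1 intrD intrM mulrNz.
by case: (sgnz_pm R m) => ->; congr (_, _, _); ring.
Qed.

Lemma hexagon2_perm m w1 w2 w3 : let f := tau w1 w2 w3 in
  (w3 = 1 - sgnz R m * (twice1 m)%:~R)%R -> (w1 + w2 = 0)%R ->
  f^-1 * expgz s2 (twice1 m) * f * expgz s1 (twice1 m)
    = s2 * s1 * expgz (s2 ^+ 2) (- m)%R * f.
Proof.
move=> f; rewrite {}/f => -> /eqP; rewrite addr_eq0 => /eqP ->; apply/permP => -[[a b] c].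
rewrite !permM !tauV !tauE s2_twice1E !tauE s1_twice1E s2E s1E s2_sqzE sgnzN !tauE.
rewrite /twice1 intrD intrM mulrNz.
by case: (sgnz_pm R m) => ->; congr (_, _, _); ring.
Qed.

Section Conj.
Variables (m : int) (w1 : R) (u' : R).
Hypothesis uK : ((twice1 m)%:~R * u' = 1)%R.
Let u : R := ((twice1 m)%:~R)%R.
Let e := sgnz R m.

(** Centres must go to centres: 0 stays fixed in the last two coordinates, where sigma_1 turns, and
    the centre (-1, -1) of the turn of sigma_2 in the outer coordinates goes to (w1 - 1, -e u), its
    translate by (w1, 1 - e u). An odd power u multiplies a quarter turn by e, so the scale factors
    of the two turning coordinates differ by e. *)
Lemma scale_subproof : injective (fun v : V =>
  (u * v.1.1 + w1 + u - 1, u * v.1.2, e * u * v.2)%R).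
Proof.
have uK' : (u' * u = 1)%R by rewrite mulrC.
apply: (can_inj (g := fun v : V =>
  (u' * (v.1.1 - w1 + 1) - 1, u' * v.1.2, e * (u' * v.2))%R)) => -[[a b] c] /=.
congr (_, _, _); last 2 first.
- by rewrite mulrA uK' mul1r.
- by rewrite mulrCA -(mulrA e) (mulrA e e) sgnz_sq mul1r mulrA uK' mul1r.
have -> : (u * a + w1 + u - 1 - w1 + 1 = u * (a + 1))%R by ring.
by rewrite mulrA uK' mul1r addrK.
Qed.

Definition scale : {perm V} := perm scale_subproof.

Lemma scaleE a b c : scale (a, b, c) = (u * a + w1 + u - 1, u * b, e * u * c)%R.
Proof. by rewrite permE. Qed.

Lemma s1_scale : s1 ^ scale = expgz s1 (twice1 m).
Proof.
apply: (mulgI scale); rewrite -conjgC; apply/permP => -[[a b] c].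
rewrite !permM s1E !scaleE s1_twice1E -/u -/e.
by congr (_, _, _); rewrite ?mulrN ?mulrA ?sgnz_sq ?mul1r //; ring.
Qed.

Lemma s2_scale : s2 ^ scale
  = (expgz s2 (twice1 m)) ^ tau w1 (- w1) (1 - e * u).
Proof.
apply: (mulgI scale); rewrite -conjgC; apply/permP => -[[a b] c].
rewrite conjgE !mulgA !permM tauV s2E !scaleE tauE s2_twice1E -/u -/e tauE.
have := sgnz_sq R m; rewrite -/e.
by case: (sgnz_pm R m) => eE; rewrite /e eE => _; congr (_, _, _); ring.
Qed.

(** Conjugation multiplies a translation by the linear part, which is the source of the term u a' in
    the composition law. *)
Lemma tau_scale v1 v2 v3 : (tau v1 v2 v3) ^ scale = tau (u * v1) (u * v2) (e * u * v3).
Proof.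
apply: (mulgI scale); rewrite -conjgC; apply/permP => -[[a b] c].
by rewrite !permM !tauE !scaleE tauE; congr (_, _, _); ring.
Qed.

End Conj.

End BraidPerms.

Arguments tau [R] (w1 w2 w3)%_R.

(** * The dihedral group acting faithfully on Z/2n *)

Section DihedralAction.
Variable n : nat.
Hypothesis n_ge3 : (3 <= n)%N.
Local Notation R := 'Z_(2 * n).

Lemma Z2n_gt1 : (1 < 2 * n)%N.
Proof. by lia. Qed.

Lemma natr_Z2n_eq0 k : (k%:R == 0 :> R)%R = (2 * n %| k)%N.
Proof.
rewrite -(Zp_nat_mod Z2n_gt1) -val_eqE /= val_Zp_nat ?Z2n_gt1 //.
by rewrite modn_mod.
Qed.

Lemma rot_subproof : injective (fun v : R => v + 2)%R.
Proof. exact: addIr. Qed.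

Definition dih_act_gen (i : bool) : {perm R} :=
  if i then perm (@oppr_inj R) else perm rot_subproof.

Lemma rotX k v : ((dih_act_gen false) ^+ k) v = (v + 2 * k%:R)%R.
Proof.
elim: k v => [|k IH] v; first by rewrite perm1 mulr0 addr0.
by rewrite expgSr permM IH permE /= -(natr1 k); ring.
Qed.

Lemma word_eval_nseq (I : choiceType) (H : groupType) (h : I -> H) k l :
  word_eval h (nseq k l) = letter_eval h l ^+ k.
Proof. by elim: k => //= k ->; rewrite expgS. Qed.

Lemma dih_act_rel u v : dihedral_relation n (u, v) ->
  word_eval dih_act_gen u = word_eval dih_act_gen v.
Proof.
case=> -[-> ->]; apply/permP => a.
- rewrite word_eval_nseq rotX perm1 -natrM.
  have -> : ((2 * n)%:R = 0 :> R)%R by apply/eqP; rewrite natr_Z2n_eq0.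
  by rewrite addr0.
- by rewrite /= /letter_eval /= mulg1 permM !permE /= opprK.
- have sV : (dih_act_gen true)^-1 = dih_act_gen true.
    by apply: invg_uniq; apply/permP => b; rewrite permM !permE /= opprK.
  rewrite /= /letter_eval /= mulg1 -/(dih_act_gen true) sV !permM !permE /=.
  by ring.
Qed.

Definition dih_act : Dn n -> {perm R} := @pres_lift _ _ _ dih_act_gen.

Lemma dih_actM : {morph dih_act : a b / a * b}.
Proof. exact: pres_liftM dih_act_rel. Qed.

Lemma dih_act_r : dih_act (dih_r n) = dih_act_gen false.
Proof. exact: (pres_lift_gen dih_act_rel). Qed.

Lemma dih_act_s : dih_act (dih_s n) = dih_act_gen true.
Proof. exact: (pres_lift_gen dih_act_rel). Qed.

Lemma dih_rn : dih_r n ^+ n = 1.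
Proof.
have rX k : dih_r n ^+ k = \pi_(pres (dihedral_relation n)) (nseq k (false, false)).
  by elim: k => // k IH; rewrite expgS IH [LHS]pi_presM.
by rewrite rX; apply/eqP/presP; apply: pres_rel; apply: Or31.
Qed.

Lemma dih_s2 : dih_s n * dih_s n = 1.
Proof.
rewrite [LHS]pi_presM; apply/eqP/presP; apply: pres_rel; exact: Or32.
Qed.

Lemma dih_srs : dih_s n * dih_r n * (dih_s n)^-1 * dih_r n = 1.
Proof.
have piM := @pi_presM _ (dihedral_relation n).
have sV : (dih_s n)^-1 = \pi_(pres (dihedral_relation n)) [:: (true, true)].
  exact: pres_invE.
rewrite sV (piM [:: _] [:: _]) (piM [:: _; _] [:: _]) (piM [:: _; _; _] [:: _]).
by apply/eqP/presP; apply: pres_rel; apply: Or33.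
Qed.

(** The inverses are r^(n-1) and s, and s r^k = r^((n-1)k) s, so putting one more letter in front of
    a word keeps the normal form. *)
Lemma dih_normal (a : Dn n) : exists k (e : bool), a = dih_r n ^+ k * dih_s n ^+ e.
Proof.
have rV : (dih_r n)^-1 = dih_r n ^+ n.-1.
  by apply: invg_uniq; rewrite -expgS prednK ?dih_rn //; lia.
have sV : (dih_s n)^-1 = dih_s n by exact: invg_uniq dih_s2.
have srX k : dih_s n * dih_r n ^+ k = dih_r n ^+ (n.-1 * k) * dih_s n.
  have h : dih_r n ^ (dih_s n)^-1 = dih_r n ^+ n.-1.
    by rewrite -rV conjgE invgK; apply: (mulIg (dih_r n)); rewrite mulgA dih_srs mulVg.
  by rewrite expgM -h -conjXg conjgE invgK -!mulgA mulVg mulg1.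
elim/quotW: a => w; elim: w => [|l w [k [e IH]]].
  by exists 0%N, false; rewrite mulg1.
have -> : \pi_(pres (dihedral_relation n)) (l :: w) =
    letter_eval (fun i => pgen _ i : Dn n) l * \pi_(pres (dihedral_relation n)) w.
  case: l => i []; rewrite /letter_eval /= ?pres_invE.
  by rewrite [X in X * _]pres_invE pi_presM.
  by rewrite pi_presM.
rewrite IH; case: l => -[] []; rewrite /letter_eval /= -/(dih_r n) -/(dih_s n).
- exists (n.-1 * k)%N, (~~ e); rewrite sV mulgA srX -mulgA; congr (_ * _).
  by case: e {IH}; rewrite /= ?mulg1 // dih_s2.
- exists (n.-1 * k)%N, (~~ e); rewrite mulgA srX -mulgA; congr (_ * _).
  by case: e {IH}; rewrite /= ?mulg1 // dih_s2.
- by exists (n.-1 + k)%N, e; rewrite rV expgD mulgA.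
- by exists k.+1, e; rewrite expgS mulgA.
Qed.

(** The image of 0 gives 2k = 0, hence n divides k; a reflection would then fix 1, that is 2 = 0
    modulo 2n, which n >= 3 excludes. *)
Lemma dih_act_faithful a : dih_act a = 1 -> a = 1.
Proof.
have [k [e ->]] := dih_normal a; rewrite dih_actM !(morph_expg dih_actM) dih_act_r dih_act_s => /permP h.
have {h} h (v : R) : ((-1) ^+ e * (v + 2 * k%:R) = v)%R.
  have := h v; rewrite perm1 permM rotX => hv; rewrite -[RHS]hv; case: e {h hv} => /=.
    by rewrite expr1 mulN1r permE.
  by rewrite perm1 mul1r.
have k0 : (2 * k%:R = 0 :> R)%R.
  have := h 0%R; rewrite add0r; case: e {h} => /=; rewrite ?expr1 ?mul1r // mulN1r => /eqP.
  by rewrite oppr_eq0 => /eqP.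
have nk : (n %| k)%N.
  by move/eqP: k0; rewrite -natrM natr_Z2n_eq0 dvdn_pmul2l.
have e0 : e = false.
  case: e h => // /(_ 1%R); rewrite k0 addr0 mulr1 expr1 => /eqP.
  rewrite eq_sym -addr_eq0 -(natrD _ 1 1) natr_Z2n_eq0 => /dvdn_leq; lia.
case/dvdnP: nk => j ->; rewrite e0 mulnC expgM dih_rn expg1n mulg1 //.
Qed.

End DihedralAction.

(** * The representation of B3 and its factorisation along the cosets of PB3 *)

Section BraidRep.
Variable R : finComNzRingType.
Local Notation V := (R * R * R)%type.

Definition rho_gen (i : bool) : {perm V} := if i then s2 R else s1 R.

Lemma rho_rel u v : braid_relation (u, v) ->
  word_eval rho_gen u = word_eval rho_gen v.
Proof.
by case=> -> ->; rewrite /= /letter_eval /= !mulg1 !mulgA s1_s2_braid.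
Qed.

Definition rho : B3 -> {perm V} := @pres_lift _ _ _ rho_gen.

Lemma rhoM : {morph rho : a b / a * b}.
Proof. exact: pres_liftM rho_rel. Qed.

Lemma rho1 : rho 1 = 1.
Proof. exact: morph_mul1 rhoM. Qed.

Lemma rhoV a : rho a^-1 = (rho a)^-1.
Proof. exact: morph_mulV rhoM a. Qed.

Lemma rho_sigma1 : rho sigma1 = s1 R.
Proof. exact: (pres_lift_gen rho_rel). Qed.

Lemma rho_sigma2 : rho sigma2 = s2 R.
Proof. exact: (pres_lift_gen rho_rel). Qed.

Lemma rho_x12 : rho (x12 : B3) = s1 R ^+ 2.
Proof. by rewrite [x12 : B3]/(sigma1 ^+ 2) expgS expg1 rhoM rho_sigma1. Qed.

Lemma rho_x23 : rho (x23 : B3) = s2 R ^+ 2.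
Proof. by rewrite [x23 : B3]/(sigma2 ^+ 2) expgS expg1 rhoM rho_sigma2. Qed.

Lemma rho_c : rho (braid_c : B3) = 1.
Proof.
have -> : (braid_c : B3) = (sigma1 * sigma2 * sigma1) * (sigma1 * sigma2 * sigma1).
  by rewrite -[LHS]/((sigma1 * sigma2 * sigma1) ^+ 2) expgS expg1.
rewrite !rhoM.
by have := s1_s2_c R; rewrite rho_sigma1 rho_sigma2 expgS expg1.
Qed.

Lemma prod_perm_subproof (p : {perm R} * {perm R} * {perm R}) :
  injective (fun v : V => (p.1.1 v.1.1, p.1.2 v.1.2, p.2 v.2)).
Proof. by move=> [[a b] c] [[a' b'] c'] [] /perm_inj -> /perm_inj -> /perm_inj ->. Qed.

Definition prod_perm p : {perm V} := perm (@prod_perm_subproof p).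

Lemma prod_permE p a b c : prod_perm p (a, b, c) = (p.1.1 a, p.1.2 b, p.2 c).
Proof. by rewrite permE. Qed.

Lemma prod_permM p q : prod_perm (p * q) = prod_perm p * prod_perm q.
Proof. by apply/permP => -[[a b] c]; rewrite permM !prod_permE /= !permM. Qed.

Definition coset_rep (t : coset6) : {perm V} :=
  match t with
  | Co => 1 | Co1 => s1 R | Co2 => s2 R
  | Co12 => s1 R * s2 R | Co21 => s2 R * s1 R | Co121 => s1 R * s2 R * s1 R
  end.

(** A coordinatewise map keeps coordinates apart, whereas every representative other than [Co] moves
    some coordinate into another slot. Two points that differ in this coordinate alone expose it. *)
Lemma prod_perm_coset_rep p t : prod_perm p = coset_rep t -> t = Co.
Proof.
have ne : (1 != 0 :> R)%R := oner_neq0 R.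
move/permP => h; have h0 := h (0, 0, 0)%R; have h1 := h (1, 0, 0)%R.
have h2 := h (0, 0, 1)%R; case: t {h} h0 h1 h2 => //= h0 h1 h2; exfalso.
- move: h0 h2; rewrite !prod_permE !s1E => -[_ -> _] [_ /eqP].
  by rewrite eq_sym (negbTE ne).
- move: h0 h1; rewrite !prod_permE !s2E => -[_ _ ->] [_ _ /eqP].
  by rewrite eq_sym (negbTE ne).
- move: h0 h1; rewrite !prod_permE !permM !s1E !s2E => -[_ _ ->] [_ _ /eqP].
  by rewrite add0r -subr_eq0 opprD addrA subrr sub0r oppr_eq0 (negbTE ne).
- move: h0 h1; rewrite !prod_permE !permM !s2E !s1E => -[_ -> _] [_ /eqP].
  by rewrite eq_sym (negbTE ne).
- move: h0 h1; rewrite !prod_permE !permM !(s2E, s1E) => -[_ -> _] [_ /eqP].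
  by rewrite add0r -subr_eq0 opprD addrA subrr sub0r oppr_eq0 (negbTE ne).
Qed.

Section Cocycle.
Variables (H : groupType) (D : H -> {perm V}) (a b : H).
Hypothesis DM : {morph D : x y / x * y}.
Hypotheses (Da : D a = s1 R ^+ 2) (Db : D b = s2 R ^+ 2).

(** Schreier rewriting inside the representation: [cocycle] is the correction in PB3 when a
    generator carries one coset representative to the next. *)
Lemma cocycle_coset_rep i t :
  D (cocycle a b 1 i t) * coset_rep (coset_next i t) = coset_rep t * rho_gen i.
Proof.
have D1 := morph_mul1 DM; have DV := morph_mulV DM.
have sq (x : {perm V}) : x ^+ 2 = x * x by rewrite expgS expg1.
have S := s1E; have T := s2E; have SS := s1_sqE; have TT := s2_sqE.
case: i t => -[] /=; rewrite ?mulg1 ?mul1g ?DM ?DV ?D1 ?Da ?Db ?mul1g ?mulg1 -?sq //.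
- apply: (mulgI (s1 R ^+ 2 * s2 R ^+ 2)); rewrite -invMg mulVKg.
  apply/permP => -[[x y] z]; rewrite !permM !(S, T, SS, TT).
  by congr (_, _, _); ring.
- by rewrite s1_s2_braid.
- apply/permP => -[[x y] z]; rewrite !permM !(S, T, SS, TT).
  by congr (_, _, _); ring.
- apply: (mulgI (s2 R ^+ 2 * s1 R ^+ 2)); rewrite -invMg mulVKg.
  apply/permP => -[[x y] z]; rewrite !permM !(S, T, SS, TT).
  by congr (_, _, _); ring.
- apply/permP => -[[x y] z]; rewrite !permM !(S, T, SS, TT).
  by congr (_, _, _); ring.
Qed.

Lemma run_coset_rep w :
  let st := run a b 1 (Co, 1) w in
  D st.2 * coset_rep st.1 = word_eval rho_gen w.
Proof.
have D1 := morph_mul1 DM; have DV := morph_mulV DM.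
suff gen st : D (run a b 1 st w).2 * coset_rep (run a b 1 st w).1 =
    D st.2 * coset_rep st.1 * word_eval rho_gen w.
  by move=> st; rewrite /st gen /= D1 !mul1g.
elim: w st => [|[i inv] w IH] [t h]; first by rewrite /= mulg1.
rewrite [run _ _ _ _ _]/(run a b 1 (letter_step a b 1 (t, h) (i, inv)) w) IH.
rewrite /= /letter_step /letter_eval /= !mulgA; congr (_ * _).
rewrite DM -!mulgA; congr (_ * _); case: inv => /=; last exact: cocycle_coset_rep.
(* For an inverse letter [letter_step] takes the cocycle at the coset reached; the identity is used
   there, and [coset_next i], an involution, leads back to [t]. *)
rewrite DV; apply: (mulgI (D (cocycle a b 1 i (coset_next i t)))).
rewrite mulVKg mulgA; apply: (mulIg (rho_gen i)); rewrite mulgKV.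
by rewrite -cocycle_coset_rep coset_nextK.
Qed.

End Cocycle.

End BraidRep.

(** * [Kn n] as the kernel of the representation *)

Section KernelOfPsi.
Variable n : nat.
Hypothesis n_ge3 : (3 <= n)%N.
Local Notation R := 'Z_(2 * n).

Definition dih3_act (p : Dn n * Dn n * Dn n) : {perm R * R * R} :=
  prod_perm (dih_act p.1.1, dih_act p.1.2, dih_act p.2).

Lemma dih3_actM : {morph dih3_act : p q / p * q}.
Proof. by move=> p q; rewrite -prod_permM /dih3_act !dih_actM. Qed.

Lemma run_dih3_act w :
  let st := run (dih_r n, dih_s n, dih_s n)
    (dih_r n * dih_s n, dih_r n, dih_r n * dih_s n) 1 (Co, 1) w in
  dih3_act st.2 * coset_rep R st.1 = word_eval (rho_gen R) w.
Proof.
apply: run_coset_rep; first exact: dih3_actM.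
  apply/permP => -[[x y] z].
  by rewrite prod_permE /= !dih_act_r // !dih_act_s // s1_sqE !permE.
apply/permP => -[[x y] z].
rewrite prod_permE /= !dih_actM // !dih_act_r // !dih_act_s // s2_sqE !permM !permE /=.
by congr (_, _, _); ring.
Qed.

(** The run that computes [psi] splits [rho R g] into the action of a dihedral triple and a coset
    representative. Coordinatewise maps detect the trivial coset, and faithfulness then kills the
    triple. *)
Lemma KnP g : Kn n g <-> rho R g = 1.
Proof.
have h := run_dih3_act (repr g); split.
  case=> p [gp psip]; move: h; rewrite /= gp run_PB3 /= mulg1.
  rewrite -[X in dih3_act X]/(psi n p) psip => e; rewrite /rho /pres_lift -e.
  exact: morph_mul1 dih3_actM.
rewrite /rho /pres_lift -h => /= h1.
have tE : (run (dih_r n, dih_s n, dih_s n)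
    (dih_r n * dih_s n, dih_r n, dih_r n * dih_s n) 1 (Co, 1) (repr g)).1 = Co.
  set st := run _ _ _ _ _ in h1 *.
  (* As the product is trivial, the representative is the action of the inverse triple, hence
     coordinatewise. *)
  apply: (@prod_perm_coset_rep _ (dih_act st.2^-1.1.1, dih_act st.2^-1.1.2, dih_act st.2^-1.2)).
  apply: (mulgI (dih3_act st.2)); rewrite -[prod_perm _]/(dih3_act _) h1 -dih3_actM mulgV.
  exact: morph_mul1 dih3_actM.
have g_PB3 : to_S3 g == 1.
  by have := run_perm (dih_r n, dih_s n, dih_s n)
    (dih_r n * dih_s n, dih_r n, dih_r n * dih_s n) 1 (Co, 1) (repr g);
    rewrite tE /= mul1g => /esym/eqP.
exists (exist _ g g_PB3); split=> //.
move: h1; rewrite tE mulg1 -[(run _ _ _ _ _).2]/(psi n (exist _ g g_PB3)).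
case: (psi n _) => [[a b] c] /permP e.
have [ea eb ec] : [/\ dih_act a = 1, dih_act b = 1 & dih_act c = 1].
  by split; apply/permP => x; have := e (x, x, x); rewrite prod_permE !perm1 => -[].
by rewrite !(dih_act_faithful n_ge3 ea, dih_act_faithful n_ge3 eb, dih_act_faithful n_ge3 ec).
Qed.

End KernelOfPsi.

(** * Quotients by a kernel, and the value of [N_ord] *)

Section QuotientByKernel.
Variables (G H : groupType) (N : set G) (r : G -> H).
Hypothesis rM : {morph r : x y / x * y}.
Hypothesis NP : forall g, N g <-> r g = 1.

Lemma quo_kernelP x y : \pi_(quo N) x = \pi_(quo N) y <-> r x = r y.
Proof.
have r1 := morph_mul1 rM; have rV := morph_mulV rM.
have -> : r x = r y <-> N (x^-1 * y).
  rewrite NP rM rV; split=> [->|h]; first by rewrite mulVg.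
  by apply: (mulgI (r x)^-1); rewrite mulVg h.
have NE : normal_closure N = N.
  apply: normal_closure_id => [|u v|u|u v]; rewrite !NP ?rM ?rV //.
  - by move=> -> ->; rewrite mulg1.
  - by move=> ->; rewrite invg1.
  - by move=> ->; rewrite mul1g mulVg.
split=> h; first by rewrite -NE; apply/quoP; rewrite h.
by apply/eqP/quoP; rewrite NE.
Qed.

Lemma quo_kernel_repr x : r (repr (\pi_(quo N) x)) = r x.
Proof. by apply/quo_kernelP; rewrite reprK. Qed.

(** Together with [quo_kernel_reprP] this embeds the quotient in [H], so that computations with
    classes become computations with permutations. *)
Lemma quo_kernel_reprM : {morph (fun q : quo N => r (repr q)) : x y / x * y}.
Proof.
by elim/quotW=> x; elim/quotW=> y; rewrite -pi_quoM !quo_kernel_repr rM.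
Qed.

Lemma quo_kernel_reprP (p q : quo N) : p = q <-> r (repr p) = r (repr q).
Proof. by rewrite -quo_kernelP !reprK. Qed.

Lemma quo_kernel_gorder x k : (0 < k)%N ->
  (forall j, r x ^+ j = 1 <-> (k %| j)%N) -> gorder (\pi_(quo N) x) = k.
Proof.
move=> k0 xk; apply: gorder_eq => // j; rewrite -xk.
rewrite -(morph_expg (@pi_quoM _ N)) -(morph_expg rM) -(morph_mul1 rM).
exact: quo_kernelP.
Qed.

End QuotientByKernel.

Section OrderOfKn.
Variable n : nat.
Hypothesis n_ge3 : (3 <= n)%N.
Local Notation R := 'Z_(2 * n).
Local Notation N := (Kn n).

Definition rhoP (p : PB3) := rho R p.
Definition rhoF (f : F2) := rho R f.

Lemma rhoPM : {morph rhoP : p q / p * q}.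
Proof. by move=> p q; rewrite /rhoP -rhoM. Qed.

Lemma rhoFM : {morph rhoF : f g / f * g}.
Proof. by move=> f g; rewrite /rhoF -rhoM. Qed.

Lemma quo_B3P x y : \pi_(quo N) x = \pi_(quo N) y <-> rho R x = rho R y.
Proof. by apply: quo_kernelP; [exact: rhoM|exact: KnP]. Qed.

Lemma quo_F2P x y : \pi_(quo (N_F2 N)) x = \pi_(quo (N_F2 N)) y <-> rhoF x = rhoF y.
Proof. by apply: quo_kernelP; [exact: rhoFM|move=> f; exact: KnP]. Qed.

Lemma signr_Z2n_eq1 k : ((-1) ^+ k == 1 :> R)%R = ~~ odd k.
Proof.
rewrite -signr_odd; case: odd; rewrite ?expr1 ?expr0 ?eqxx //.
by apply/negbTE; rewrite eq_sym -addr_eq0 -(natrD _ 1 1) natr_Z2n_eq0 // gtnNdvd //; lia.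
Qed.

Lemma intr_Z2n_eq0 (k : int) : (k%:~R == 0 :> R)%R = (Posz (2 * n)%N %| k)%Z.
Proof.
by case: k => k; rewrite ?NegzE ?mulrNz ?oppr_eq0 dvdzE ?abszN; exact: natr_Z2n_eq0.
Qed.

Lemma intr_Z2nP (a b : int) :
  (a%:~R = b%:~R :> R)%R <-> (Posz (2 * n)%N %| (a - b)%R)%Z.
Proof.
rewrite -intr_Z2n_eq0 intrB subr_eq0.
by split=> /eqP.
Qed.

Lemma N_ordE : N_ord N = lcmn n 2.
Proof.
have P p k : (0 < k)%N -> (forall j, rhoP p ^+ j = 1 <-> (k %| j)%N) ->
    gorder (\pi_(quo (N_PB3 N)) p) = k.
  by apply: quo_kernel_gorder; [exact: rhoPM|move=> g; exact: KnP].
(* The j-th powers of x12 and x23 are trivial exactly under these conditions: one for the rotation,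
   one for the reflections. *)
have ord_lcm j : (2 * j%:R = 0 :> R)%R /\ ((-1) ^+ j = 1 :> R)%R <-> (lcmn n 2 %| j)%N.
  rewrite dvdn_lcm -natrM; split.
    case=> /eqP; rewrite natr_Z2n_eq0 // dvdn_pmul2l // => -> /eqP.
    by rewrite signr_Z2n_eq1 dvdn2.
  case/andP=> nj; rewrite dvdn2 -signr_Z2n_eq1 => /eqP ->; split=> //.
  by apply/eqP; rewrite natr_Z2n_eq0 // dvdn_pmul2l.
have l0 : (0 < lcmn n 2)%N by rewrite lcmn_gt0; lia.
rewrite /N_ord (P x12 (lcmn n 2)) // ?(P x23 (lcmn n 2)) ?(P braid_c 1%N) //.
- by rewrite lcmn1; apply/lcmn_idPr.
- by move=> j; rewrite /rhoP rho_c expg1n dvd1n.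
- move=> j; rewrite -ord_lcm /rhoP rho_x23.
  have E a b c : (s2 R ^+ 2 ^+ j) (a, b, c) =
      ((-1) ^+ j * (a + 1) - 1, b + 2 * j%:R, (-1) ^+ j * (c + 1) - 1)%R.
    exact: (s2_sqzE j%:Z).
  split=> [/permP /(_ (0, 0, 0)%R)|[j0 e1]].
    rewrite E perm1 !add0r mulr1 => /eqP.
    by rewrite !xpair_eqE subr_eq0 => /andP[/andP[/eqP -> /eqP ->] _].
  by apply/permP => -[[a b] c]; rewrite E perm1 e1 j0 !mul1r !addrK addr0.
- move=> j; rewrite -ord_lcm /rhoP rho_x12.
  have E a b c : (s1 R ^+ 2 ^+ j) (a, b, c) =
      (a + 2 * j%:R, (-1) ^+ j * b, (-1) ^+ j * c)%R.
    exact: (s1_sqzE j%:Z).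
  (* Here the sign changes are centred at 0, so the origin would not see the sign; for x23 they are
     centred at -1 and the origin was enough. *)
  split=> [/permP /(_ (0, 1, 1)%R)|[j0 e1]].
    rewrite E perm1 !add0r mulr1 => /eqP.
    by rewrite !xpair_eqE => /andP[/andP[/eqP -> /eqP ->] _].
  by apply/permP => -[[a b] c]; rewrite E perm1 e1 j0 !mul1r addr0.
Qed.

End OrderOfKn.

(** * The commutator subgroup of F2 in the representation *)

Section PureForm.
Variable R : finComNzRingType.
Local Notation V := (R * R * R)%type.

(* The linear part is diagonal, with signs determined by the exponent sums i of
   x and j of y; so is the translation part modulo 4. *)
Definition pure_form (p : {perm V}) (i j k1 k2 k3 : int) : Prop :=
  forall a b c, p (a, b, c) =
    (sgnz R j * a + (2 * i + 2 * j + 4 * k1)%:~R,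
     sgnz R i * b + (2 * j + 4 * k2)%:~R,
     sgnz R i * sgnz R j * c + (2 * j + 4 * k3)%:~R)%R.

Lemma sgnz_int (m : int) : sgnz R m = (sgnz int m)%:~R%R.
Proof. by rewrite /sgnz rmorphXn rmorphN1. Qed.

Lemma pure_formM p i j k1 k2 k3 p' i' j' k1' k2' k3' :
  pure_form p i j k1 k2 k3 -> pure_form p' i' j' k1' k2' k3' ->
  exists l1 l2 l3, pure_form (p * p') (i + i')%R (j + j')%R l1 l2 l3.
Proof.
move=> hp hp'.
(* Changing the sign of 2A alters it by a multiple of 4; this is why translation parts modulo 4
   depend on the exponent sums alone. *)
have sg (s : int) (A : int) : s = 1%R \/ s = (-1)%R ->
    exists d, (s%:~R * (2 * A)%:~R = (2 * A + 4 * d)%:~R :> R)%R.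
  by case=> ->; [exists 0%R|exists (- A)%R]; rewrite -intrM; congr (_%:~R)%R; ring.
have [d1] := sg _ (i + j + 2 * k1)%R (sgnz_pm int j').
have [d2] := sg _ (j + 2 * k2)%R (sgnz_pm int i').
have [d3] := sg _ (j + 2 * k3)%R (sgnz_pm int (i' + j')).
rewrite -!sgnz_int => e3 e2 e1.
exists (k1 + k1' + d1)%R, (k2 + k2' + d2)%R, (k3 + k3' + d3)%R => a b c.
have E1 : (2 * i + 2 * j + 4 * k1 = 2 * (i + j + 2 * k1))%R by ring.
have E2 : (2 * j + 4 * k2 = 2 * (j + 2 * k2))%R by ring.
have E3 : (2 * j + 4 * k3 = 2 * (j + 2 * k3))%R by ring.
rewrite permM hp hp' !mulrDr E1 E2 E3 -sgnzD e1 e2 e3 !sgnzD.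
by congr (_, _, _); rewrite !(intrD, intrM); ring.
Qed.

Lemma pure_formV p i j k1 k2 k3 : pure_form p i j k1 k2 k3 ->
  exists l1 l2 l3, pure_form p^-1 (- i)%R (- j)%R l1 l2 l3.
Proof.
move=> hp.
have sg (s : int) (A : int) : s = 1%R \/ s = (-1)%R ->
    exists d, (s%:~R * (2 * A)%:~R = (2 * A + 4 * d)%:~R :> R)%R.
  by case=> ->; [exists 0%R|exists (- A)%R]; rewrite -intrM; congr (_%:~R)%R; ring.
have [d1] := sg _ (- i - j - 2 * k1)%R (sgnz_pm int j).
have [d2] := sg _ (- j - 2 * k2)%R (sgnz_pm int i).
have [d3] := sg _ (- j - 2 * k3)%R (sgnz_pm int (i + j)).
rewrite -!sgnz_int => e3 e2 e1.
exists (- k1 + d1)%R, (- k2 + d2)%R, (- k3 + d3)%R => a b c.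
apply: (@perm_inj _ p); rewrite permKV hp !sgnzN.
have F1 : ((2 * - i + 2 * - j + 4 * (- k1 + d1))%:~R = sgnz R j * (2 * (- i - j - 2 * k1))%:~R)%R.
  by rewrite e1; congr (_%:~R)%R; ring.
have F2 : ((2 * - j + 4 * (- k2 + d2))%:~R = sgnz R i * (2 * (- j - 2 * k2))%:~R)%R.
  by rewrite e2; congr (_%:~R)%R; ring.
have F3 : ((2 * - j + 4 * (- k3 + d3))%:~R = sgnz R i * sgnz R j * (2 * (- j - 2 * k3))%:~R)%R.
  by rewrite -sgnzD e3; congr (_%:~R)%R; ring.
rewrite F1 F2 F3 -sgnzD -!mulrDr !mulrA !sgnz_sq !mul1r.
by congr (_, _, _); rewrite !(intrD, intrM, intrN, intrB); ring.
Qed.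

Lemma pure_form_F2 (p : PB3) : gen [set g : PB3 | g = x12 \/ g = x23]%classic p ->
  exists i j k1 k2 k3, pure_form (rho R p) i j k1 k2 k3.
Proof.
elim=> [q [->|->]||q r _ [i [j [k1 [k2 [k3 hq]]]]] _ [i' [j' [k1' [k2' [k3' hr]]]]]
  |q _ [i [j [k1 [k2 [k3 hq]]]]]].
- exists 1%R, 0%R, 0%R, 0%R, 0%R => a b c; rewrite rho_x12 s1_sqE /sgnz /=.
  by congr (_, _, _); ring.
- exists 0%R, 1%R, (-1)%R, 0%R, (-1)%R => a b c; rewrite rho_x23 s2_sqE /sgnz /=.
  by congr (_, _, _); ring.
- exists 0%R, 0%R, 0%R, 0%R, 0%R => a b c; rewrite -[((1 : PB3) : B3)]/(1 : B3) rho1 perm1 /sgnz /=.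
  by congr (_, _, _); ring.
- have [l1 [l2 [l3 h]]] := pure_formM hq hr.
  rewrite -rhoM in h; by exists (i + i')%R, (j + j')%R, l1, l2, l3.
- have [l1 [l2 [l3 h]]] := pure_formV hq.
  rewrite -rhoV in h; by exists (- i)%R, (- j)%R, l1, l2, l3.
Qed.

Definition comm_translation (p : {perm V}) : Prop := exists a b c : int,
  [/\ p = tau (4 * a)%:~R (4 * b)%:~R (4 * c)%:~R, (2 %| (a - b)%R)%Z & (2 %| (a - c)%R)%Z].

Lemma comm_translationM p q :
  comm_translation p -> comm_translation q -> comm_translation (p * q).
Proof.
move=> [a [b [c [-> ab ac]]]] [a' [b' [c' [-> ab' ac']]]].
exists (a + a')%R, (b + b')%R, (c + c')%R; split; [|lia|lia].
by rewrite tauM !mulrDr !intrD.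
Qed.

Lemma comm_translationV p : comm_translation p -> comm_translation p^-1.
Proof.
move=> [a [b [c [-> ab ac]]]].
exists (- a)%R, (- b)%R, (- c)%R; split; [|lia|lia].
by rewrite tauV !mulrN !intrN.
Qed.

(** Writing a sign as 1 - 2t with a bit t makes the commutator formulas polynomial, so that parities
    can be compared. *)
Lemma sgnz_bit (m : int) : exists t d : int,
  [/\ sgnz R m = (1 - 2 * t)%:~R%R, m = (t + 2 * d)%R & t = 0%R \/ t = 1%R].
Proof.
case mE : (odd `|m|%N).
  exists 1%R, ((m - 1) %/ 2)%Z; split; [|lia|by right].
  by rewrite /sgnz -signr_odd mE expr1; ring.
exists 0%R, (m %/ 2)%Z; split; [|lia|by left].
by rewrite /sgnz -signr_odd mE expr0.
Qed.

Lemma pure_form_comm p i j k1 k2 k3 p' i' j' k1' k2' k3' :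
  pure_form p i j k1 k2 k3 -> pure_form p' i' j' k1' k2' k3' ->
  comm_translation [~ p, p'].
Proof.
move=> hp hp'.
have [t [d [tE iE t01]]] := sgnz_bit i; have [s [c [sE jE s01]]] := sgnz_bit j.
have [t' [d' [tE' iE' t01']]] := sgnz_bit i'; have [s' [c' [sE' jE' s01']]] := sgnz_bit j'.
(* For v -> (1 - 2s)v + T and v -> (1 - 2s')v + T' the commutator translates by 2(s T' - s' T). In
   the third coordinate the bit is t + s - 2ts, the exclusive or. Modulo 2 all three witnesses
   reduce to s t' - s' t, since i and j have the parities of t and s. *)
exists (s * (i' + j' + 2 * k1') - s' * (i + j + 2 * k1))%R.
exists (t * (j' + 2 * k2') - t' * (j + 2 * k2))%R.
exists ((t + s - 2 * t * s) * (j' + 2 * k3') - (t' + s' - 2 * t' * s') * (j + 2 * k3))%R.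
split.
- apply: (mulgI (p' * p)); rewrite -commgC; apply/permP => -[[x y] z].
  rewrite !permM hp !hp' hp tauE tE sE tE' sE'.
  by congr (_, _, _); rewrite !(intrD, intrM, intrN, intrB); ring.
- by rewrite ?iE jE iE' jE'; case: t01 t01' s01 s01' => -> [] -> [] -> [] ->; lia.
- by rewrite ?iE jE iE' jE'; case: t01 t01' s01 s01' => -> [] -> [] -> [] ->; lia.
Qed.

End PureForm.

Lemma comm_s1_sq_s2_sq (R : finComNzRingType) :
  [~ s1 R ^+ 2, s2 R ^+ 2] = tau (-4)%:~R 4%:~R (-4)%:~R.
Proof.
move: (s1 R ^+ 2) (s2 R ^+ 2) (@s1_sqE R) (@s2_sqE R) => p q pE qE.
apply: (mulgI (q * p)); rewrite -commgC.
apply/permP => -[[a b] c]; rewrite !permM pE !qE pE tauE.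
by congr (_, _, _); ring.
Qed.

Lemma tau_conj_s1_sq (R : finComNzRingType) (a b c : R) :
  tau a b c ^ (s1 R ^+ 2) = tau a (- b) (- c).
Proof.
move: (s1 R ^+ 2) (@s1_sqE R) => p pE; apply: (mulgI p); rewrite -conjgC.
apply/permP => -[[x y] z]; rewrite !permM tauE !pE tauE.
by congr (_, _, _); ring.
Qed.

Lemma tau_conj_s2_sq (R : finComNzRingType) (a b c : R) :
  tau a b c ^ (s2 R ^+ 2) = tau (- a) b (- c).
Proof.
move: (s2 R ^+ 2) (@s2_sqE R) => p pE; apply: (mulgI p); rewrite -conjgC.
apply/permP => -[[x y] z]; rewrite !permM tauE !pE tauE.
by congr (_, _, _); ring.
Qed.

Lemma expgz_tau (R : finComNzRingType) (a b c : int) m :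
  expgz (tau a%:~R b%:~R c%:~R : {perm R * R * R}) m
  = tau (m * a)%:~R (m * b)%:~R (m * c)%:~R.
Proof.
symmetry; move: m; apply: expgz_uniq => [|m]; first by rewrite !mul0r tau0.
by rewrite tauM -!intrD !mulrDl !mul1r.
Qed.

Section CommutatorSubgroup.
Variable n : nat.
Hypothesis n_ge3 : (3 <= n)%N.
Local Notation R := 'Z_(2 * n).
Local Notation N := (Kn n).

Lemma rhoF_x : rhoF n xF2 = s1 R ^+ 2.
Proof. exact: rho_x12. Qed.

Lemma rhoF_y : rhoF n yF2 = s2 R ^+ 2.
Proof. exact: rho_x23. Qed.

Lemma comm_translation_lift p : comm_translation p -> exists f,
  rhoF n f = p /\ commutator_subgroup (\pi_(quo (N_F2 N)) f).
Proof.
have rM := @rhoFM n; case=> a [b [c [-> ab ac]]].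
pose k := [~ xF2, yF2].
(* Divided by 4, the translations of [k] and of its conjugates by x and y are (-1, 1, -1), (-1, -1,
   1) and (1, 1, 1). They span the triples of equal parity, and [i], [j], [l] solve the linear
   system for (a, b, c). *)
have [i iE] : exists i, (b - a = 2 * i)%R by exists ((b - a) %/ 2)%Z; lia.
have [j jE] : exists j, (c - a = 2 * j)%R by exists ((c - a) %/ 2)%Z; lia.
have [l lE] : exists l, (b + c = 2 * l)%R by exists ((b + c) %/ 2)%Z; lia.
exists (expgz k i * expgz (k ^ xF2) j * expgz (k ^ yF2) l); split.
  rewrite !rM !(expgz_morph rM) !(morph_conj rM) !(morph_comm rM).
  rewrite rhoF_x rhoF_y comm_s1_sq_s2_sq tau_conj_s1_sq tau_conj_s2_sq -!intrN.
  rewrite !expgz_tau !tauM -!intrD.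
  by congr (tau _%:~R _%:~R _%:~R); lia.
have piM := @pi_quoM _ (N_F2 N).
have comm_in x y z : commutator_subgroup (\pi_(quo (N_F2 N)) ([~ x, y] ^ z)).
  rewrite conjRg (morph_comm piM); apply: gen_in.
  by exists (\pi_(quo (N_F2 N)) (x ^ z)), (\pi_(quo (N_F2 N)) (y ^ z)).
rewrite !piM !(expgz_morph piM).
apply: gen_M; [apply: gen_M|]; apply: gen_expgz; try exact: comm_in.
by rewrite -(conjg1 k); exact: comm_in.
Qed.

Lemma commutator_subgroupP f :
  commutator_subgroup (\pi_(quo (N_F2 N)) f) <-> comm_translation (rhoF n f).
Proof.
have KF g : N_F2 N g <-> rhoF n g = 1 by exact: KnP.
have rM := @rhoFM n; split.
  rewrite -(quo_kernel_repr rM KF f); move: (\pi_(quo _) f) => {f} q.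
  have rqM := quo_kernel_reprM rM KF.
  elim=> [_ [x [y ->]]||x y _ IHx _ IHy|x _ IHx].
  - have form (z : F2) : exists i j k1 k2 k3, pure_form (rhoF n z) i j k1 k2 k3.
      by apply: pure_form_F2; apply/set_mem; exact: (valP z).
    rewrite (morph_comm rqM).
    have [i [j [k1 [k2 [k3 hx]]]]] := form (repr x).
    have [i' [j' [k1' [k2' [k3' hy]]]]] := form (repr y).
    exact: pure_form_comm hx hy.
  - rewrite (morph_mul1 rqM); exists 0%R, 0%R, 0%R; split=> //.
    by rewrite mulr0 tau0.
  - by rewrite rqM; exact: comm_translationM.
  - by rewrite (morph_mulV rqM); exact: comm_translationV.
move=> /comm_translation_lift[g [gE comm]].
by have /quo_F2P -> : rhoF n f = rhoF n g by rewrite gE.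
Qed.

End CommutatorSubgroup.

(** * Shadows of [Kn n] as integer pairs *)

Lemma B3_lift (H : groupType) (h1 h2 : H) : h1 * h2 * h1 = h2 * h1 * h2 ->
  exists T : {multiplicative B3 -> H}, T sigma1 = h1 /\ T sigma2 = h2.
Proof.
move=> br; pose h (i : bool) := if i then h2 else h1.
have hR u v : braid_relation (u, v) -> word_eval h u = word_eval h v.
  by case=> -> ->; rewrite /= /letter_eval /= !mulg1 !mulgA.
pose T : {multiplicative B3 -> H} := HB.pack (@pres_lift _ _ _ h : B3 -> H)
  (isMultiplicative.Build B3 H (@pres_lift _ _ _ h) (pres_liftM hR)).
by exists T; split; apply: (pres_lift_gen hR).
Qed.

Lemma B3_morph_eq (H : groupType) (f g : B3 -> H) :
  {morph f : x y / x * y} -> {morph g : x y / x * y} ->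
  f sigma1 = g sigma1 -> f sigma2 = g sigma2 -> f =1 g.
Proof.
move=> fM gM e1 e2; elim/quotW=> w; elim: w => [|[i b] w IH].
  by rewrite -[\pi _]/(1 : B3) (morph_mul1 fM) (morph_mul1 gM).
have -> : \pi_B3 ((i, b) :: w) = \pi_B3 [:: (i, b)] * \pi_B3 w by rewrite pi_presM.
rewrite fM gM IH; congr (_ * _).
have e : f (pgen _ i) = g (pgen _ i) by case: i.
case: b => //.
have -> : \pi_B3 [:: (i, true)] = (pgen braid_relation i)^-1 by rewrite [RHS]pres_invE.
by rewrite (morph_mulV fM) (morph_mulV gM) e.
Qed.

Lemma expg1z (G : groupType) m : expgz (1 : G) m = 1.
Proof. by symmetry; move: m; apply: expgz_uniq => // m; rewrite mulg1. Qed.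

Lemma coprime_twice1 m k : coprime `|twice1 m|%N (lcmn k 2) = coprime `|twice1 m|%N k.
Proof.
have odd_u : odd `|twice1 m|%N by rewrite /twice1; lia.
apply/idP/idP => [|ck]; first exact/coprime_dvdr/dvdn_lcml.
apply: (@coprime_dvdr _ (k * 2)); first by rewrite dvdn_lcm dvdn_mulr // dvdn_mull.
by rewrite coprimeMr ck coprimen2.
Qed.

(** The sign (-1)^m is the residue of 2m + 1 modulo 4. *)
Lemma one_sub_sgnz_twice1_quarter m : exists c, (1 - sgnz int m * twice1 m = 4 * c)%R.
Proof.
exists ((1 - sgnz int m * twice1 m) %/ 4)%Z; rewrite /sgnz -signr_odd.
by case mE: (odd _); rewrite ?expr1 ?expr0 /twice1; lia.
Qed.

Section Shadow.
Variable n : nat.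
Hypothesis n_ge3 : (3 <= n)%N.
Local Notation R := 'Z_(2 * n).
Local Notation N := (Kn n).

Lemma hexagon1P m f w1 w2 w3 : rhoF n f = tau w1 w2 w3 ->
  hexagon1 N m f <-> (w3 = 1 - sgnz R m * (twice1 m)%:~R /\ w1 + w2 = 0)%R.
Proof.
move=> fE; rewrite -hexagon1_perm /hexagon1 quo_B3P // -fE.
rewrite !rhoM rhoV !(expgz_morph (@rhoM R)) rho_sigma1 rho_sigma2 rho_x12 rho_c.
by rewrite expg1z mulg1.
Qed.

Lemma hexagon2_of m f w1 w2 w3 : rhoF n f = tau w1 w2 w3 ->
  (w3 = 1 - sgnz R m * (twice1 m)%:~R)%R -> (w1 + w2 = 0)%R -> hexagon2 N m f.
Proof.
move=> fE h3 h12; rewrite /hexagon2 quo_B3P //.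
rewrite !rhoM rhoV !(expgz_morph (@rhoM R)) rho_sigma1 rho_sigma2 rho_x23 rho_c.
by rewrite expg1z mulg1 -[rho R f]/(rhoF n f) fE hexagon2_perm.
Qed.

Lemma coprime_unit m : coprime `|twice1 m|%N n ->
  exists u', ((twice1 m)%:~R * u' = 1 :> R)%R.
Proof.
move=> cop; have odd_u : odd `|twice1 m|%N by rewrite /twice1; lia.
have cop2 : coprimez (twice1 m) (Posz (2 * n)%N).
  by rewrite coprimezE /= coprimeMr cop coprimen2 odd_u.
have [x [y xy]] := Bezoutz (twice1 m) (Posz (2 * n)%N).
exists (x%:~R)%R; rewrite -intrM; apply/(intr_Z2nP n_ge3 _ 1%R).
rewrite (eqP cop2) in xy; rewrite -xy.
by apply/dvdzP; exists (- y)%R; ring.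
Qed.

Section Conjugation.
Variables (m a : int) (f : F2) (u' : R).
Hypothesis uK : ((twice1 m)%:~R * u' = 1 :> R)%R.
Hypothesis fE : rhoF n f =
  tau (4 * a)%:~R (- (4 * a)%:~R) (1 - sgnz R m * (twice1 m)%:~R).

Let h := scale ((4 * a)%:~R)%R uK.

(* T_{m,f} is conjugation by h. *)
Lemma rho_sigma1_scale : rho R (expgz sigma1 (twice1 m)) = rho R sigma1 ^ h.
Proof. by rewrite (expgz_morph (@rhoM R)) rho_sigma1 s1_scale. Qed.

Lemma rho_sigma2_scale :
  rho R ((f : B3)^-1 * expgz sigma2 (twice1 m) * (f : B3)) = rho R sigma2 ^ h.
Proof.
rewrite !rhoM rhoV (expgz_morph (@rhoM R)) rho_sigma2 s2_scale -fE conjgE.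
by rewrite !mulgA.
Qed.

Lemma T_exists : exists T : {multiplicative B3 -> quo N},
  is_T m f T /\ forall q : quo N, exists g : B3, T g = q.
Proof.
set t1 := \pi_(quo N) (expgz sigma1 (twice1 m)).
set t2 := \pi_(quo N) ((f : B3)^-1 * expgz sigma2 (twice1 m) * (f : B3)).
have [|T [T1 T2]] := @B3_lift (quo N) t1 t2.
  rewrite /t1 /t2; move: rho_sigma1_scale rho_sigma2_scale.
  move: (expgz sigma1 _) (_ * _ * _) => A B e1 e2; have piM := @pi_quoM _ N.
  rewrite -(piM A B) -(piM B A) -(piM (A * B) A) -(piM (B * A) B).
  apply/quo_B3P => //; rewrite !rhoM e1 e2 -!conjMg rho_sigma1 rho_sigma2.
  by rewrite s1_s2_braid.
exists T; split=> // q.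
have KB : forall g, N g <-> rho R g = 1 by move=> g; exact: KnP.
have Th b : rho R (repr (T b)) = rho R b ^ h.
  apply: (@B3_morph_eq _ (fun b => rho R (repr (T b))) (fun b => rho R b ^ h)).
  - by move=> x y; rewrite gmulfM (quo_kernel_reprM (@rhoM R) KB).
  - by move=> x y; rewrite rhoM conjMg.
  - by rewrite T1 (quo_kernel_repr (@rhoM R) KB) rho_sigma1_scale.
  - by rewrite T2 (quo_kernel_repr (@rhoM R) KB) rho_sigma2_scale.
(* Conjugation by [h] is injective and, because it is induced by [T], maps the finite image of [rho]
   into itself; hence it permutes this image, which makes [T] surjective. *)
pose I := [set p | `[< exists b, rho R b = p >]]%SET.
have sub : [set p ^ h | p in I]%SET \subset I.
  apply/fintype.subsetP => _ /imsetP[p + ->]; rewrite !finset.in_set => /asboolP[b <-].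
  by apply/asboolP; exists (repr (T b)); rewrite Th.
have /eqP/setP/(_ (rho R (repr q))) : [set p ^ h | p in I]%SET == I.
  by rewrite eqEcard sub card_imset ?leqnn // => x y; exact: conjg_inj.
have -> : (rho R (repr q) \in I) = true.
  by rewrite finset.in_set; apply/asboolP; exists (repr q).
case/imsetP => p; rewrite finset.in_set => /asboolP[b <-] qE.
exists b; apply/(quo_kernel_reprP (@rhoM R) KB).
by rewrite Th qE.
Qed.

(** Both sides are multiplicative in [g], and on x and y the claim is the square of the statement
    for sigma_1 and sigma_2. *)
Lemma rhoF_E g : rhoF n (E_endo m f g) = rhoF n g ^ h.
Proof.
set u := expgz xF2 (twice1 m); set v := f^-1 * expgz yF2 (twice1 m) * f.
have zc (k : F2) : k * 1 = 1 * k by rewrite mulg1 mul1g.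
(* The induction on [gen] runs over elements of PB3, so the endomorphism is first extended to PB3 by
   sending c to 1. *)
pose Q (p : PB3) := rhoF n (PB3_map u v 1 p).
have QM : {morph Q : x y / x * y}.
  by move=> x y; rewrite /Q PB3_mapM // rhoFM.
suff : forall p, gen [set g : PB3 | g = x12 \/ g = x23]%classic p -> Q p = rhoP n p ^ h.
  by apply; apply/set_mem; exact: (valP g).
move=> p; elim=> [q [->|->]||x y _ IHx _ IHy|x _ IHx].
- rewrite /Q PB3_map_x12 // /u (expgz_morph (@rhoFM n)) rhoF_x /rhoP rho_x12.
  by rewrite expgz_sqr conjXg s1_scale.
- rewrite /Q PB3_map_x23 // /v !rhoFM (morph_mulV (@rhoFM n)).
  rewrite (expgz_morph (@rhoFM n)) rhoF_y /rhoP rho_x23 expgz_sqr conjXg s2_scale.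
  by rewrite -conjXg -fE; move: (_ ^+ 2) => s; rewrite conjgE mulgA.
- by rewrite (morph_mul1 QM) (morph_mul1 (@rhoPM n)) conj1g.
- by rewrite QM IHx IHy rhoPM conjMg.
- by rewrite (morph_mulV QM) IHx (morph_mulV (@rhoPM n)) conjVg.
Qed.

End Conjugation.

(* Modulo 8, because the third coordinate of the translation is
   4 * ((1 - e u) / 4) and its quotient by 4 has the parity of a. For n not
   divisible by 4 the integer a can be shifted so as to achieve this. *)
Definition shadow_data (m a : int) : Prop :=
  coprime `|twice1 m|%N n /\
  (8%:Z %| (1 - sgnz int m * twice1 m - 4 * a)%R)%Z.

Definition shadow_form (m a : int) (f : F2) : Prop := rhoF n f =
  tau (4 * a)%:~R (- (4 * a)%:~R) (1 - sgnz R m * (twice1 m)%:~R).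

Lemma one_sub_sgnz_twice1_intr m c : (1 - sgnz int m * twice1 m = 4 * c)%R ->
  (1 - sgnz R m * (twice1 m)%:~R = (4 * c)%:~R :> R)%R.
Proof. by move=> <-; rewrite sgnz_int intrB intrM. Qed.

Lemma shadow_of m a f : shadow_data m a -> shadow_form m a f -> is_GT_shadow N m f.
Proof.
move=> [cop d8] fE; have [u' uK] := coprime_unit cop.
split.
- have h12 : ((4 * a)%:~R + - (4 * a)%:~R = 0 :> R)%R by rewrite subrr.
  by split; [apply/(hexagon1P _ fE)|exact: hexagon2_of fE _ _].
- rewrite N_ordE //; have := coprime_twice1 m n; rewrite cop => /eqP.
  by rewrite /gcdz => ->.
(* The triple of the translation is (a, -a, c), and [d8] says that c has the parity of a. *)
- apply/commutator_subgroupP => //; have [c cE] := one_sub_sgnz_twice1_quarter m.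
  exists a, (- a)%R, c; split; [|lia|lia].
  by rewrite fE (one_sub_sgnz_twice1_intr cE) mulrN intrN.
- exact: T_exists uK fE.
Qed.

Lemma shadow_form_exists m f : hexagon1 N m f -> coprime `|twice1 m|%N n ->
  comm_translation (rhoF n f) -> exists a, shadow_data m a /\ shadow_form m a f.
Proof.
move=> hex1 cop [a [b [c [fE ab ac]]]].
have [c0 c0E] := one_sub_sgnz_twice1_quarter m.
have [+ +] := proj1 (hexagon1P m fE) hex1.
rewrite (one_sub_sgnz_twice1_intr c0E) => h3 /eqP; rewrite addr_eq0 => /eqP h12.
have [a' [/(intr_Z2nP n_ge3) ea' par]] :
    exists a', (2 * n %| (4 * a' - 4 * a)%R)%Z /\ (2 %| (a' - c0)%R)%Z.
  move/(intr_Z2nP n_ge3)/dvdzP: h3 => [k kE].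
  have [ac0|ac0] := boolP (2 %| (a - c0)%R)%Z.
    by exists a; rewrite subrr dvdz0.
  (* Adding n for odd n, or n/2 for n twice an odd number, flips the parity of a and changes 4a by a
     multiple of 2n. *)
  have [odd_n|even_n] := boolP (odd n).
    by exists (a + n%:Z)%R; split; [apply/dvdzP; exists 2%R|]; lia.
  have nE : n = (2 * n./2)%N by lia.
  have odd_half : odd n./2.
    (* If 4 divides n, then c - c0 is a multiple of the even number n/2, and a, which has the parity
       of c, already has that of c0. *)
    apply: contraNT ac0 => even_half; have n4 : n = (4 * n./2./2)%N by lia.
    have : (c - c0 = k * (2 * (n./2./2)%:Z))%R by rewrite n4 in kE; lia.
    by lia.
  by exists (a + n./2%:Z)%R; split; [apply/dvdzP; exists 1%R|]; lia.
exists a'; split; first by split=> //; rewrite c0E; lia.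
by rewrite /shadow_form fE ea' h3 (one_sub_sgnz_twice1_intr c0E); congr tau; rewrite h12 opprK.
Qed.

End Shadow.

(** * Classes, composition, and reduction to integer pairs *)

Lemma Zmod_piP k (a b : int) : \pi_(Zmod k) a = \pi_(Zmod k) b <-> (k %| (a - b)%R)%Z.
Proof.
rewrite -eqz_mod_dvd; split=> [/eqP|h]; first by rewrite eqmodE.
by apply/eqP; rewrite eqmodE.
Qed.

Lemma coprime_congr (q : nat) (u v : int) :
  (q %| (u - v)%R)%Z -> coprime `|u|%N q = coprime `|v|%N q.
Proof.
move=> /dvdzP[k uv]; have cE (w : int) : coprime `|w|%N q = coprimez q w.
  by rewrite coprimezE coprime_sym.
have uE : (u = k * q + v)%R by rewrite -uv subrK.
by rewrite !cE uE /coprimez gcdzMDl.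
Qed.

Lemma twice1_comp m m' : twice1 (GT_comp_m m m') = (twice1 m * twice1 m')%R.
Proof. by rewrite /twice1 /GT_comp_m; ring. Qed.

Lemma sgnz_comp (S : comPzRingType) m m' :
  sgnz S (GT_comp_m m m') = (sgnz S m * sgnz S m')%R.
Proof.
rewrite -sgnzD /GT_comp_m /sgnz -[LHS]signr_odd -[RHS]signr_odd.
by congr (_ ^+ _)%R; congr nat_of_bool; lia.
Qed.

(** Modulo 8 one has (1 - 4a)(1 - 4a') = 1 - 4(a + a'), and multiplying a' by an odd number keeps
    its parity. *)
Lemma shadow_data_comp n m a m' a' : shadow_data n m a -> shadow_data n m' a' ->
  shadow_data n (GT_comp_m m m') (a + twice1 m * a')%R.
Proof.
move=> [cop /dvdzP[k kE]] [cop' /dvdzP[k' kE']].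
rewrite /shadow_data twice1_comp abszM coprimeMl cop cop'; split=> //.
rewrite sgnz_comp.
have X : (sgnz int m * twice1 m = 1 - 4 * a - k * 8)%R by lia.
have X' : (sgnz int m' * twice1 m' = 1 - 4 * a' - k' * 8)%R by lia.
rewrite mulrACA X X'; apply/dvdzP.
exists (k' + k - 2 * a * a' - 4 * a * k' - 4 * k * a' - 8 * k * k' - m * a')%R.
by rewrite /twice1; ring.
Qed.

Section Composition.
Variable n : nat.
Hypothesis n_ge3 : (3 <= n)%N.
Local Notation R := 'Z_(2 * n).
Local Notation N := (Kn n).

Lemma GT_classP m f m' f' : GT_class N m f = GT_class N m' f' <->
  (lcmn n 2 %| (m - m')%R)%Z /\ rhoF n f = rhoF n f'.
Proof.
rewrite -(N_ordE n_ge3) -Zmod_piP -quo_F2P //.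
by rewrite /GT_class; split=> [[-> ->]|[-> ->]].
Qed.

(** The modulus is even, which fixes the sign, and a multiple of n, which fixes 2m + 1 modulo 2n. *)
Lemma twice1_congr m m' : (lcmn n 2 %| (m - m')%R)%Z ->
  [/\ coprime `|twice1 m|%N n = coprime `|twice1 m'|%N n,
      sgnz R m = sgnz R m' & ((twice1 m)%:~R = (twice1 m')%:~R :> R)%R].
Proof.
move=> /dvdzP[k mE].
have [x xE] : exists x, lcmn n 2 = (n * x)%N.
  by have /dvdnP[x ->] := dvdn_lcml n 2; exists x; rewrite mulnC.
have [y yE] : exists y, lcmn n 2 = (2 * y)%N.
  by have /dvdnP[y ->] := dvdn_lcmr n 2; exists y; rewrite mulnC.
have uE : (twice1 m = twice1 m' + (2 * k * x) * n)%R by rewrite /twice1; lia.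
split.
- by apply: coprime_congr; rewrite uE addrC addKr; exact: dvdz_mull.
- have m2E : (m = m' + 2 * (k * y))%R by rewrite yE in mE; lia.
  rewrite m2E sgnzD /sgnz -[X in (_ * X)%R]signr_odd.
  by rewrite (_ : odd _ = false) ?mulr1 // abszM oddM.
- by apply/(intr_Z2nP n_ge3); rewrite uE; apply/dvdzP; exists (k * x)%R; lia.
Qed.

Lemma shadow_form_classP m a f m' a' f' : shadow_form n m a f -> shadow_form n m' a' f' ->
  GT_class N m f = GT_class N m' f' <->
  (lcmn n 2 %| (m - m')%R)%Z /\ ((2 * n)%N %| (4 * a - 4 * a')%R)%Z.
Proof.
move=> fE fE'; rewrite GT_classP fE fE'; split=> -[mm'].
  by case/tau_inj => /(intr_Z2nP n_ge3).
have [_ -> ->] := twice1_congr mm'.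
by move=> /(intr_Z2nP n_ge3) ->.
Qed.

(** Membership provides the shadow conditions for some representative of the class; they are carried
    over to the given [m] and [f]. *)
Lemma GT_form m f : GT N (GT_class N m f) ->
  exists a, shadow_data n m a /\ shadow_form n m a f.
Proof.
case=> m' [f' [[[hex _] cop comm _]]] /GT_classP[mm' ff'].
have [copE sE uE] := twice1_congr mm'.
move/(commutator_subgroupP n_ge3): comm; rewrite -ff' => comm.
apply: shadow_form_exists => //.
  have [a [b [c [fE ab ac]]]] := comm.
  apply/(hexagon1P n_ge3 m fE); rewrite sE uE.
  by rewrite ff' in fE; apply/(hexagon1P n_ge3 m' fE).
by rewrite copE -coprime_twice1 -(N_ordE n_ge3); move: cop; rewrite /gcdz => -[/eqP].
Qed.

Lemma shadow_form_lift m a : shadow_data n m a -> exists f, shadow_form n m a f.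
Proof.
move=> [_ d8]; have [c cE] := one_sub_sgnz_twice1_quarter m.
have [|f [fE _]] := @comm_translation_lift n n_ge3 (tau (4 * a)%:~R (4 * - a)%:~R (4 * c)%:~R).
  by exists a, (- a)%R, c; split=> //; lia.
by exists f; rewrite /shadow_form (one_sub_sgnz_twice1_intr _ cE) fE mulrN intrN.
Qed.

Lemma shadow_form_comp m a f m' a' f' : shadow_data n m a ->
  shadow_form n m a f -> shadow_form n m' a' f' ->
  shadow_form n (GT_comp_m m m') (a + twice1 m * a')%R (GT_comp_f m f f').
Proof.
move=> [cop _] fE fE'; have [u' uK] := coprime_unit n_ge3 cop.
rewrite /shadow_form /GT_comp_f rhoFM (rhoF_E uK fE) fE fE' tau_scale tauM.
rewrite twice1_comp sgnz_comp; congr tau; rewrite !(intrM, intrD); ring.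
Qed.

End Composition.

(** [Q] plays the role of the graph of the isomorphism on integer representatives. The first
    hypothesis makes it both single-valued and injective on classes, the next two make it total and
    onto, the last multiplicative. *)
Lemma GT_isog_of_rel (n : nat) (n_ge3 : (3 <= n)%N) (G : groupType)
    (Q : int -> int -> G -> Prop) :
  (forall m a g m' a' g', shadow_data n m a -> shadow_data n m' a' ->
     Q m a g -> Q m' a' g' -> g = g' <->
     (lcmn n 2 %| (m - m')%R)%Z /\ ((2 * n)%N %| (4 * a - 4 * a')%R)%Z) ->
  (forall m a, shadow_data n m a -> exists g, Q m a g) ->
  (forall g, exists m a, shadow_data n m a /\ Q m a g) ->
  (forall m a g m' a' g', Q m a g -> Q m' a' g' ->
     Q (GT_comp_m m m') (a + twice1 m * a')%R (g * g')) ->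
  GT_isog (Kn n) G.
Proof.
move=> Qeq Qtot Qsurj QM.
pose P s g := exists m a f, [/\ shadow_data n m a, shadow_form n m a f,
  s = GT_class (Kn n) m f & Q m a g].
(* The default 1 is taken only outside [GT]; on [GT] the value exists by [Qtot] and is unique by
   [Qeq]. *)
pose phi s := xget 1 (P s).
have phiE m a f g : shadow_data n m a -> shadow_form n m a f -> Q m a g ->
    phi (GT_class (Kn n) m f) = g.
  move=> d fE q; apply: xget_unique; first by exists m, a, f.
  move=> g' [m' [a' [f' [d' fE' s' q']]]].
  apply/(Qeq _ _ _ _ _ _ d' d q' q).
  by apply/(shadow_form_classP n_ge3 fE' fE).
exists phi; split.
  split=> //.
  - move=> s s' /set_mem[m [f [sh ->]]] /set_mem[m' [f' [sh' ->]]].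
    have [a [d fE]] : exists a, shadow_data n m a /\ shadow_form n m a f.
      by apply: GT_form => //; exists m, f.
    have [a' [d' fE']] : exists a, shadow_data n m' a /\ shadow_form n m' a f'.
      by apply: GT_form => //; exists m', f'.
    have [g q] := Qtot _ _ d; have [g' q'] := Qtot _ _ d'.
    rewrite (phiE _ _ _ _ d fE q) (phiE _ _ _ _ d' fE' q') => gg'.
    by apply/(shadow_form_classP n_ge3 fE fE')/(Qeq _ _ _ _ _ _ d d' q q').
  - move=> g _; have [m [a [d q]]] := Qsurj g.
    have [f fE] := shadow_form_lift n_ge3 d.
    exists (GT_class (Kn n) m f); last exact: phiE d fE q.
    by exists m, f; split=> //; exact: shadow_of d fE.
move=> m1 f1 m2 f2 /(GT_form n_ge3)[a1 [d1 fE1]] /(GT_form n_ge3)[a2 [d2 fE2]] s.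
have d := shadow_data_comp d1 d2.
have fE := shadow_form_comp n_ge3 d1 fE1 fE2.
have [g1 q1] := Qtot _ _ d1; have [g2 q2] := Qtot _ _ d2.
split; first by exists (GT_comp_m m1 m2), (GT_comp_f m1 f1 f2); split=> //; exact: shadow_of d fE.
rewrite (phiE _ _ _ _ d1 fE1 q1) (phiE _ _ _ _ d2 fE2 q2).
by apply: phiE d fE _; exact: QM.
Qed.

(** * Chinese remainders, semidirect coordinates, units modulo powers of 2 *)

Lemma chinesez (p q a b : int) : coprimez p q ->
  exists x, (p %| (x - a)%R)%Z /\ (q %| (x - b)%R)%Z.
Proof.
move=> /eqP cop; have [x [y]] := Bezoutz p q; rewrite cop => xy.
have yq : (y * q = 1 - x * p)%R by rewrite -xy; ring.
exists (a * (y * q) + b * (x * p))%R; split; apply/dvdzP.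
  by exists (x * (b - a))%R; rewrite yq; ring.
by exists (y * (a - b))%R; rewrite mulrAC yq; ring.
Qed.

Lemma dvdz_mul_coprime (p q : nat) (x : int) : coprime p q ->
  ((p * q)%N %| x)%Z = (p %| x)%Z && (q %| x)%Z.
Proof. by move=> cop; rewrite !dvdzE /= Gauss_dvd. Qed.

Section SemidirectCoordinates.
Variables (n q : nat) (q_gt0 : (0 < q)%N) (n_q : n %| q).
Local Notation sd := (semidirect q_gt0 n_q).
Implicit Types (p : sd) (k u : int).

(** A relation with arbitrary integers, so that the formulas in m and a can be used without being
    reduced to canonical residues. *)
Definition sd_coord p k u : Prop :=
  (n %| (k - (sd_k p)%:Z)%R)%Z /\ (q %| (u - (sd_u p)%:Z)%R)%Z.

Lemma sd_coord_eq p k u p' k' u' : sd_coord p k u -> sd_coord p' k' u' ->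
  p = p' <-> (n %| (k - k')%R)%Z /\ (q %| (u - u')%R)%Z.
Proof.
move=> [pk pu] [pk' pu'].
have shift (d a b x y : int) : (d %| (a - x)%R)%Z -> (d %| (b - y)%R)%Z ->
    (d %| (a - b)%R)%Z = (d %| (x - y)%R)%Z.
  move=> ax byy; have -> : (a - b = (x - y) + ((a - x) - (b - y)))%R by ring.
  by rewrite rpredDr // rpredB.
rewrite (shift _ _ _ _ _ pk pk') (shift _ _ _ _ _ pu pu'); split=> [->|].
  by rewrite !subrr !dvdz0.
rewrite -!eqz_mod_dvd !modz_nat => -[/eqP[ek] /eqP[eu]].
exact: sd_eq.
Qed.

Lemma sd_coord_exists k u : coprime `|u|%N q -> exists p, sd_coord p k u.
Proof.
move=> cop; have n_gt0 : (0 < n)%N := dvdn_gt0 q_gt0 n_q.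
have [k' kE] : exists k' : nat, (k %% n)%Z = Posz k'.
  by exists `|(k %% n)%Z|%N; rewrite gez0_abs // modz_ge0 //; lia.
have [u' uE] : exists u' : nat, (u %% q)%Z = Posz u'.
  by exists `|(u %% q)%Z|%N; rewrite gez0_abs // modz_ge0 //; lia.
have cop' : coprime u' q.
  by move: cop; rewrite -(coprimezE u q%:Z) /coprimez -gcdz_modl uE.
exists (sd_mk q_gt0 n_q k' cop'); split.
  rewrite -eqz_mod_dvd [sd_k _]/(k' %% n)%N -modz_nat -kE !modz_mod //.
rewrite -eqz_mod_dvd [sd_u _]/(u' %% q)%N -modz_nat -uE !modz_mod //.
Qed.

Lemma sd_coordM p k u p' k' u' : sd_coord p k u -> sd_coord p' k' u' ->
  sd_coord (p * p') (k + u * k')%R (u * u')%R.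
Proof.
move=> [pk pu] [pk' pu']; split.
  rewrite -eqz_mod_dvd [sd_k _]/((sd_k p + sd_u p * sd_k p') %% n)%N -modz_nat modz_mod.
  rewrite eqz_mod_dvd PoszD PoszM.
  have -> : (k + u * k' - ((sd_k p)%:Z + (sd_u p)%:Z * (sd_k p')%:Z))%R =
    ((k - (sd_k p)%:Z) + ((u - (sd_u p)%:Z) * k' + (sd_u p)%:Z * (k' - (sd_k p')%:Z)))%R by ring.
  rewrite rpredD // rpredD //; last exact: dvdz_mull.
  by apply/dvdz_mulr/(dvdz_trans _ pu).
rewrite -eqz_mod_dvd [sd_u _]/((sd_u p * sd_u p') %% q)%N -modz_nat modz_mod.
rewrite eqz_mod_dvd PoszM.
have -> : (u * u' - (sd_u p)%:Z * (sd_u p')%:Z =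
  (u - (sd_u p)%:Z) * u' + (sd_u p)%:Z * (u' - (sd_u p')%:Z))%R by ring.
by rewrite rpredD //; [exact: dvdz_mulr|exact: dvdz_mull].
Qed.

End SemidirectCoordinates.

Lemma exp5_pow2 k : exists j, (5 ^ (2 ^ k) = 1 + 2 ^ (k + 2) * (2 * j + 1))%N.
Proof.
elim: k => [|k [j IH]]; first by exists 0%N.
(* With d = 2j + 1, squaring 1 + 2^(k+2) d gives 1 + 2^(k+3) (d + 2^(k+1) d^2). *)
exists (j + 2 ^ k * (2 * j + 1) ^ 2)%N.
rewrite expnSr expnM IH !expnD !expnS; lia.
Qed.

Lemma pow5_mod_pow2 k (v : int) : (4%:Z %| (v - 1)%R)%Z ->
  exists b : nat, ((2 ^ (k + 2))%N %| (v - 5 ^+ b)%R)%Z.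
Proof.
move=> v1; elim: k => [|k [b /dvdzP[x xE]]]; first by exists 0%N.
have pE : (2 ^ (k.+1 + 2) = 2 ^ (k + 2) * 2)%N by rewrite addSn expnSr.
have [j jE] := exp5_pow2 k.
have [t tE] : exists t : int, (5 ^+ b = 2 * t + 1 :> int)%R.
  elim: b {xE} => [|b [t IH]]; first by exists 0%R.
  by exists (5 * t + 2)%R; rewrite exprS IH; ring.
have [s [x0|x1]] : exists s : int, (x = 2 * s \/ x = 2 * s + 1)%R.
- by exists (x %/ 2)%Z; lia.
- exists b; apply/dvdzP; exists s; rewrite xE x0 pE PoszM; ring.
(* An odd quotient is repaired by the extra factor 5^(2^k): it adds an odd multiple of 2^(k+2) and
   so gains one more binary digit. *)
exists (b + 2 ^ k)%N; apply/dvdzP.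
exists (s - t * (2 * j%:Z + 1) - j%:Z)%R.
have -> : (v = 5 ^+ b + x * (2 ^ (k + 2))%N%:Z)%R by rewrite -xE; ring.
have e : ((5 : int) ^+ (2 ^ k)%N = 1 + (2 ^ (k + 2))%N%:Z * (2 * j%:Z + 1))%R.
  have -> : ((5 : int) ^+ (2 ^ k)%N = (5 ^ (2 ^ k))%N%:Z)%R by rewrite -natrX natz.
  by rewrite jE PoszD PoszM PoszD PoszM.
rewrite exprD e x1 pE !PoszM tE; ring.
Qed.

Lemma odd_mod_pow2 k (u : int) : odd `|u|%N ->
  exists a b : nat, ((2 ^ (k + 2))%N %| (u - (-1) ^+ a * 5 ^+ b)%R)%Z.
Proof.
move=> u_odd; have [u1|u3] : (4%:Z %| (u - 1)%R)%Z \/ (4%:Z %| (- u - 1)%R)%Z by lia.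
  by have [b bE] := pow5_mod_pow2 k u1; exists 0%N, b; rewrite mul1r.
have [b bE] := pow5_mod_pow2 k u3; exists 1%N, b.
have -> : (u - (-1) ^+ 1 * 5 ^+ b = - (- u - 5 ^+ b))%R by ring.
by rewrite rpredN.
Qed.

Lemma sgnz_parity (m : int) :
  (sgnz int m = 1 /\ (2 %| m)%Z)%R \/ (sgnz int m = -1 /\ ~~ (2 %| m)%Z)%R.
Proof.
rewrite /sgnz -signr_odd; case mE : (odd _); [right|left]; rewrite ?expr1 ?expr0; lia.
Qed.

Lemma pow5_mod8 b : exists t : int, ((5 : int) ^+ b = 1 + 4 * b%:Z + 8 * t)%R.
Proof.
elim: b => [|b [t IH]]; first by exists 0%R.
by exists (2 * b%:Z + 5 * t)%R; rewrite exprS IH; lia.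
Qed.

(** Of u and -u, both e u and 5^b are the one that is 1 modulo 4, up to multiples of 8. Hence e u =
    5^b = 1 + 4b modulo 8, and (1 - e u)/4 has the parity of b. *)
Lemma shadow_parity (m a : int) (i b : nat) :
  (8%:Z %| (twice1 m - (-1) ^+ i * 5 ^+ b)%R)%Z ->
  (8%:Z %| (1 - sgnz int m * twice1 m - 4 * a)%R)%Z = (2 %| (a - b%:Z)%R)%Z.
Proof.
have [t ->] := pow5_mod8 b; rewrite -(signr_odd _ i) /twice1.
by case: (sgnz_parity m) => -[->] mE; case: odd; rewrite ?expr1 ?expr0; lia.
Qed.

Section Moduli.
Variables (n0 alpha : nat).
Hypothesis n0_odd : odd n0.
Let n := (n0 * 2 ^ alpha)%N.

Lemma coprime_odd_pow2 k : coprime n0 (2 ^ k).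
Proof. by rewrite coprimeXr // coprimen2. Qed.

Lemma coprime_odd_mul2 u : odd u -> coprime u n = coprime u n0.
Proof.
move=> u_odd; rewrite /n coprimeMr andbC.
by rewrite coprimeXr // coprimen2.
Qed.

Lemma dvdz_lcm_n2 (x : int) :
  (lcmn n 2 %| x)%Z = [&& (n0 %| x)%Z, ((2 ^ alpha)%N %| x)%Z & (2 %| x)%Z].
Proof.
rewrite andbA -dvdz_mul_coprime ?coprime_odd_pow2 //.
by rewrite !dvdzE dvdn_lcm.
Qed.

(** The factor 4 is invertible at the odd part. At 2 the remaining condition concerns x modulo
    2^(alpha-1) if alpha >= 2 and is empty if alpha < 2. *)
Lemma dvdz_2n_4mul (x : int) :
  ((2 * n)%N %| (4 * x)%R)%Z = (n0 %| x)%Z && ((2 ^ alpha.+1)%N %| (4 * x)%R)%Z.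
Proof.
have -> : (2 * n = n0 * 2 ^ alpha.+1)%N by rewrite expnS mulnCA.
rewrite dvdz_mul_coprime ?coprime_odd_pow2 //; congr (_ && _).
by rewrite !dvdzE abszM /= Gauss_dvdr // (coprime_odd_pow2 2).
Qed.

Lemma dvdz_odd_2mul (x : int) : (n0 %| (2 * x)%R)%Z = (n0 %| x)%Z.
Proof. by rewrite !dvdzE abszM /= Gauss_dvdr // coprimen2. Qed.

End Moduli.

(** * The isomorphisms for small and large alpha *)

Lemma odd_eq_twice1 (u : int) : odd `|u|%N -> exists m, u = twice1 m.
Proof. by move=> u_odd; exists ((u - 1) %/ 2)%Z; rewrite /twice1; lia. Qed.

Lemma odd_twice1 m : odd `|twice1 m|%N.
Proof. by rewrite /twice1; lia. Qed.

Lemma twice1B m m' : (twice1 m - twice1 m' = 2 * (m - m'))%R.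
Proof. by rewrite /twice1; ring. Qed.

Lemma Z2_eqP (z z' : 'Z_2) : z = z' <-> (2 %| (z%:Z - z'%:Z)%R)%Z.
Proof.
split=> [->|zz']; first by rewrite subrr dvdz0.
apply: val_inj => /=; have := ltn_ord z; have := ltn_ord z'.
by move: zz'; case: z => z ? /=; case: z' => z' ? /=; rewrite /Zp_trunc /=; lia.
Qed.

Lemma GT_isog_alpha_lt2 (n n0 alpha : nat) (n_ge3 : (3 <= n)%N)
    (nE : n = (n0 * 2 ^ alpha)%N) (n0_odd : odd n0) : (alpha < 2)%N ->
  GT_isog (Kn n) (Aff (odd_gt0 n0_odd) * 'Z_2)%type.
Proof.
move=> alpha_lt2.
(* At the prime 2 nothing of a survives and only the parity of m is left, which becomes the second
   factor. *)
pose Q (m a : int) (g : Aff (odd_gt0 n0_odd) * 'Z_2) :=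
  sd_coord (g.1 : semidirect (odd_gt0 n0_odd) (dvdnn n0)) a (twice1 m) /\
  (2 %| (m - (g.2 : nat)%:Z)%R)%Z.
have pow_dvd (d : nat) (x : int) : (2 ^ d %| 2)%N -> (2 %| x)%Z -> ((2 ^ d)%N %| x)%Z.
  by move=> d2; apply: dvdz_trans; rewrite dvdzE.
apply: (@GT_isog_of_rel n n_ge3 (Aff (odd_gt0 n0_odd) * 'Z_2)%type Q).
- move=> m a [p z] m' a' [p' z'] _ _ [/= pE zE] [/= pE' zE'].
  rewrite -mulrBr nE dvdz_2n_4mul // dvdz_lcm_n2 //.
  have -> : ((p, z) = (p', z')) <-> (p = p' /\ (2 %| (m - m')%R)%Z).
    have -> : (2 %| (m - m')%R)%Z = (2 %| (z%:Z - z'%:Z)%R)%Z by lia.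
    by rewrite -Z2_eqP; split=> [[-> ->]|[-> ->]].
  rewrite (sd_coord_eq pE pE') twice1B dvdz_odd_2mul //.
  split=> [[[-> ->] mm']|[/and3P[-> _ ->] /andP[-> _]]] //; split.
    rewrite mm' andbT; apply: pow_dvd mm'.
    by move: alpha_lt2; case: (alpha) => [|[|]].
  rewrite /=; apply: (@dvdz_trans 4); last exact: dvdz_mulr.
  by move: alpha_lt2; case: (alpha) => [|[|]].
- move=> m a [cop _].
  have [|p pE] := @sd_coord_exists n0 n0 (odd_gt0 n0_odd) (dvdnn n0) a (twice1 m).
    by apply: coprime_dvdr cop; rewrite nE dvdn_mulr.
  by exists (p, inZp `|m|%N); split=> //=; rewrite /Zp_trunc /=; lia.
- move=> [p z].
  (* The residue 1 + 2z modulo 4 gives m the parity of z. Afterwards a is free modulo 2 and is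
     chosen to meet [shadow_data]. *)
  have [|u [up uz]] := @chinesez n0 4 (sd_u p) (1 + 2 * (z : nat)%:Z)%R.
    by rewrite coprimezE /= (coprime_odd_pow2 n0_odd 2).
  have u_odd : odd `|u|%N by lia.
  have [m uE] := odd_eq_twice1 u_odd; have [c cE] := one_sub_sgnz_twice1_quarter m.
  have [|a [ap ac]] := @chinesez n0 2 (sd_k p) c.
    by rewrite coprimezE /= (coprime_odd_pow2 n0_odd 1).
  exists m, a; split; last by split; rewrite /= -?uE //; rewrite uE /twice1 in uz; lia.
  split; last by rewrite cE; lia.
  rewrite -uE nE coprime_odd_mul2 // (coprime_congr up).
  exact: (@sd_uP n0 n0 (odd_gt0 n0_odd) (dvdnn n0) p).
- move=> m a [p z] m' a' [p' z'] [/= pE zE] [/= pE' zE']; split=> /=.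
    by rewrite twice1_comp; exact: sd_coordM.
  move: zE zE'; rewrite /GT_comp_m; case: z => z ?; case: z' => z' ? /=.
  by rewrite /Zp_trunc /=; lia.
Qed.

(** For alpha >= 2, 8 divides 2^(alpha+1) and 2 divides 2^(alpha-1), so the residues stored in [p]
    suffice to read off both parities of [shadow_parity]. *)
Lemma Htilde_coordP (alpha : nat) (p : semidirect2 alpha) (m a : int) (b i : nat) :
  (2 <= alpha)%N ->
  sd_coord (p : semidirect (pow2_gt0 (alpha + 1)) (pow2_dvd alpha)) a (twice1 m) ->
  (Posz (sd_u p) = (-1) ^+ i * 5 ^+ b %[mod Posz (2 ^ (alpha + 1))%N])%Z ->
  (8%:Z %| (1 - sgnz int m * twice1 m - 4 * a)%R)%Z <-> (sd_k p = b %[mod 2])%N.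
Proof.
move=> alpha_ge2 [pk pu] /eqP; rewrite eqz_mod_dvd => pb.
have d8 : (8%:Z %| Posz (2 ^ (alpha + 1))%N)%Z by rewrite dvdzE /= (@dvdn_exp2l 2 3) //; lia.
have d2 : (2%:Z %| Posz (2 ^ (alpha - 1))%N)%Z by rewrite dvdzE /= (@dvdn_exp2l 2 1) //; lia.
rewrite (@shadow_parity m a i b); last first.
  have := rpredD (dvdz_trans d8 pu) (dvdz_trans d8 pb).
  by rewrite addrA subrK.
by have := dvdz_trans d2 pk; lia.
Qed.

Lemma GT_isog_alpha_ge2 (n n0 alpha : nat) (n_ge3 : (3 <= n)%N)
    (nE : n = (n0 * 2 ^ alpha)%N) (n0_odd : odd n0) : (2 <= alpha)%N ->
  GT_isog (Kn n) (Aff (odd_gt0 n0_odd) * subg_of (Htilde alpha))%type.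
Proof.
move=> alpha_ge2.
(* One integer pair (a, u) is reduced in both factors, so that both products reduce the single law
   (a + u a', u u'). *)
pose Q (m a : int) (g : Aff (odd_gt0 n0_odd) * subg_of (Htilde alpha)) :=
  sd_coord (g.1 : semidirect (odd_gt0 n0_odd) (dvdnn n0)) a (twice1 m) /\
  sd_coord (sgval g.2 : semidirect (pow2_gt0 (alpha + 1)) (pow2_dvd alpha)) a (twice1 m).
have pmul (k d : nat) (x : int) : (0 < k)%N ->
    ((k * d)%N %| (k%:Z * x)%R)%Z = (d %| x)%Z.
  by move=> k0; rewrite !dvdzE abszM dvdn_pmul2l.
apply: (@GT_isog_of_rel n n_ge3 (Aff (odd_gt0 n0_odd) * subg_of (Htilde alpha))%type Q).
- move=> m a [p h] m' a' [p' h'] _ _ [/= pE hE] [/= pE' hE'].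
  rewrite -mulrBr nE dvdz_2n_4mul // dvdz_lcm_n2 //.
  have -> : ((p, h) = (p', h')) <-> (p = p' /\ sgval h = sgval h').
    by split=> [[-> ->]|[-> /val_inj ->]].
  rewrite (sd_coord_eq pE pE') (sd_coord_eq hE hE') twice1B dvdz_odd_2mul //.
  have -> : (2 ^ (alpha + 1) = 2 * 2 ^ alpha)%N by rewrite addn1 expnS.
  have -> : (2 ^ alpha.+1 = 4 * 2 ^ (alpha - 1))%N.
    by rewrite -(expnD 2 2); congr (_ ^ _)%N; lia.
  rewrite !pmul //; split=> [[[-> ->] [-> mm']]|[/and3P[-> -> _] /andP[-> ->]]] //.
  split=> //; rewrite mm' /=; apply: dvdz_trans mm'.
  by rewrite dvdzE /= (@dvdn_exp2l 2 1) //; lia.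
- move=> m a [cop d8].
  have [|p pE] := @sd_coord_exists n0 n0 (odd_gt0 n0_odd) (dvdnn n0) a (twice1 m).
    by apply: coprime_dvdr cop; rewrite nE dvdn_mulr.
  have [|h hE] := @sd_coord_exists _ _ (pow2_gt0 (alpha + 1)) (pow2_dvd alpha) a (twice1 m).
    by rewrite coprimeXr // coprimen2 odd_twice1.
  have [i [b ib]] := odd_mod_pow2 (alpha - 1) (odd_twice1 m).
  have hb : (Posz (sd_u h) = (-1) ^+ i * 5 ^+ b %[mod Posz (2 ^ (alpha + 1))%N])%Z.
    apply/eqP; rewrite eqz_mod_dvd.
    have e : (alpha - 1 + 2 = alpha + 1)%N by lia.
    rewrite e in ib; have := rpredB ib hE.2.
    by rewrite opprB addrC addrA subrK.
  have hH : h \in Htilde alpha.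
    rewrite finset.in_set; apply/asboolP; exists i, b; split=> //.
    exact/(Htilde_coordP alpha_ge2 hE hb).
  by exists (p, Subg hH).
- move=> [p h]; have := subgP h; rewrite finset.in_set => /asboolP[i [b [hu hk]]].
  have [|u [up uh]] := @chinesez n0 (2 ^ (alpha + 1))%N (sd_u p) (sd_u (sgval h)).
    by rewrite coprimezE /= coprime_odd_pow2.
  have u_odd : odd `|u|%N.
    have := sd_uP (sgval h : semidirect (pow2_gt0 (alpha + 1)) (pow2_dvd alpha)).
    by rewrite -(coprime_congr uh) addn1 coprime_pexpr // coprimen2.
  have [m uE] := odd_eq_twice1 u_odd.
  have [|a [ap ah]] := @chinesez n0 (2 ^ (alpha - 1))%N (sd_k p) (sd_k (sgval h)).
    by rewrite coprimezE /= coprime_odd_pow2.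
  have hE : sd_coord (sgval h : semidirect (pow2_gt0 (alpha + 1)) (pow2_dvd alpha)) a (twice1 m).
    by split; rewrite -?uE.
  exists m, a; split; last by split; [split; rewrite -?uE|].
  split; last exact/(Htilde_coordP alpha_ge2 hE hu).
  rewrite -uE nE coprime_odd_mul2 // (coprime_congr up).
  exact: (@sd_uP n0 n0 (odd_gt0 n0_odd) (dvdnn n0) p).
- move=> m a [p h] m' a' [p' h'] [/= pE hE] [/= pE' hE']; split=> /=.
    by rewrite twice1_comp; exact: sd_coordM.
  by rewrite twice1_comp; exact: sd_coordM.
Qed.

Theorem theorem4p6 (n n0 alpha : nat) (n_ge3 : (3 <= n)%N)
    (nE : n = (n0 * 2 ^ alpha)%N) (n0_odd : odd n0) :
  ((alpha < 2)%N ->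
     GT_isog (Kn n) (Aff (odd_gt0 n0_odd) * 'Z_2)%type) /\
  ((2 <= alpha)%N ->
     GT_isog (Kn n) (Aff (odd_gt0 n0_odd) * subg_of (Htilde alpha))%type).
Proof. by split; [exact: GT_isog_alpha_lt2|exact: GT_isog_alpha_ge2]. Qed.
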